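(* Let $H$ be an involution-free graph and let $r$ be a positive integer. There is a polynomial-time Turing reduction from $\oplus r\textsc{-PinnedHomsTo}H$ to $\oplus\textsc{HomsTo}H$.
   Context: Graphs are finite and simple. An involution of a graph is an automorphism of order $2$; $H$ is involution-free if it has none. $\mathrm{Orb}_H(h)$ denotes the orbit of $h\in V(H)$ under the automorphism group $\mathrm{Aut}(H)$. For graphs $G,H$ and a function $p:V(G)\to 2^{V(H)}$, $\mathrm{Hom}(G,H,p)$ denotes the set of homomorphisms $f$ from $G$ to $H$ with $f(v)\in p(v)$ for all $v\in V(G)$. The function $p$ is $r$-restrictive if there is a set $\{x_1,\dots,x_r\}\subseteq V(G)$ such that for each $i\in[r]$ there is $W_i\subseteq V(H)$ with $p(x_i)=\bigcup_{h\in W_i}\mathrm{Orb}_H(h)$, and $p(w)=V(H)$ for every other vertex $w$. $\oplus r\textsc{-PinnedHomsTo}H$: given a graph $G$ and an $r$-restrictive $p:V(G)\to 2^{V(H)}$, compute $|\mathrm{Hom}(G,H,p)|\bmod 2$. $\oplus\textsc{HomsTo}H$: given a graph $G$, compute the number of homomorphisms from $G$ to $H$ modulo $2$. *)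

(* Defs.v *)
From HB Require Import structures.
From mathcomp Require Import all_boot all_order all_fingroup all_algebra.

Set Implicit Arguments.
Unset Strict Implicit.
Unset Printing Implicit Defensive.

Record sgraph (V : finType) := SGraph {
  adj :> rel V;
  adj_sym : symmetric adj;
  adj_irr : irreflexive adj
}.

Definition Aut_graph (V : finType) (H : sgraph V) : {set {perm V}} :=
  [set s : {perm V} | [forall x, forall y, H (s x) (s y) == H x y]].

Definition involution_free (V : finType) (H : sgraph V) : Prop :=
  ~ exists2 s : {perm V}, s \in Aut_graph H & #[s]%g = 2.

Definition Orb (V : finType) (H : sgraph V) (h : V) : {set V} :=
  orbit 'P%act (Aut_graph H) h.

Section Homs.

Variables (V T : finType) (G : sgraph V) (H : sgraph T).

Definition is_hom (f : {ffun V -> T}) : bool :=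
  [forall u, forall v, G u v ==> H (f u) (f v)].

Definition Hom : {set {ffun V -> T}} := [set f | is_hom f].

Definition Hom_pinned (p : V -> {set T}) : {set {ffun V -> T}} :=
  [set f | is_hom f & [forall v, f v \in p v]].

Definition restrictive (r : nat) (p : V -> {set T}) : Prop :=
  exists x : 'I_r -> V,
    (forall i, exists W : {set T}, p (x i) = \bigcup_(h in W) Orb H h) /\
    (forall w, (forall i, w <> x i) -> p w = [set: T]).

End Homs.

(* Deterministic multi-tape oracle Turing machines.  A tape symbol is None    *)
(* (the blank), Some (inl b) (the bit b), or Some (inr a) with a an auxiliary *)
(* symbol of the machine.                                                     *)

Variant dir := MoveL | Stay | MoveR.

Definition symbol (A : finType) : Type := option (bool + A).

(* Ask q: consult the oracle, and continue in state q. *)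
Variant action (A Q I : finType) :=
  | Halt
  | Ask of Q
  | Act of Q & (I -> symbol A * dir).

Record oracle_machine := OracleMachine {
  aux : finType;
  state : finType;
  tapes : finType;
  input_tape : tapes;
  query_tape : tapes;
  output_tape : tapes;
  start : state;
  delta : state -> (tapes -> symbol aux) -> action aux state tapes
}.

(* A two-way infinite tape: the cells to the left of the head, nearest first, *)
(* and the cells from the scanned one rightwards; all other cells are blank.  *)
Definition tape (A : finType) : Type := (seq (symbol A) * seq (symbol A))%type.

Section Tapes.

Variable A : finType.
Implicit Types (t : tape A) (s : symbol A).

Definition blank_tape : tape A := ([::], [::]).

Definition tape_of_bits (w : seq bool) : tape A :=
  ([::], [seq Some (inl b) | b <- w]).

Definition read t : symbol A := head None t.2.

Definition write s t : tape A := (t.1, s :: behead t.2).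

Definition move d t : tape A :=
  match d with
  | MoveL => (behead t.1, head None t.1 :: t.2)
  | Stay => t
  | MoveR => (head None t.2 :: t.1, behead t.2)
  end.

Fixpoint leading_bits (c : seq (symbol A)) : seq bool :=
  if c is Some (inl b) :: c' then b :: leading_bits c' else [::].

(* The string held by a tape starts at the scanned cell and ends before the   *)
(* first symbol that is not a bit.                                            *)
Definition bits_of_tape t : seq bool := leading_bits t.2.

End Tapes.

Section Semantics.

Variables (M : oracle_machine) (O : seq bool -> seq bool).

Record config := Config {
  cstate : state M;
  ctapes : tapes M -> tape (aux M)
}.

Definition init (w : seq bool) : config :=
  Config (start M)
    (fun i => if i == input_tape M then tape_of_bits (aux M) w
              else blank_tape (aux M)).

(* None when the machine has halted.  A query costs one step and replaces the *)
(* contents of the query tape by the answer.                                  *)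
Definition step (c : config) : option config :=
  match delta (cstate c) (fun i => read (ctapes c i)) with
  | Halt => None
  | Ask q =>
      Some (Config q
        (fun i => if i == query_tape M
                  then tape_of_bits (aux M) (O (bits_of_tape (ctapes c i)))
                  else ctapes c i))
  | Act q a =>
      Some (Config q (fun i => move (a i).2 (write (a i).1 (ctapes c i))))
  end.

Fixpoint halts_within (t : nat) (c c' : config) : Prop :=
  match step c with
  | None => c = c'
  | Some c1 => if t is t'.+1 then halts_within t' c1 c' else False
  end.

Definition computes_within (t : nat) (w y : seq bool) : Prop :=
  exists2 c : config, halts_within t (init w) c
    & bits_of_tape (ctapes c (output_tape M)) = y.

End Semantics.

Record problem := Problem {
  instance : Type;
  encode : instance -> seq bool;
  answer : instance -> seq bool
}.

(* No condition is put on strings that encode no instance. *)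
Definition solves (O : seq bool -> seq bool) (P : problem) : Prop :=
  forall x : instance P, O (encode x) = answer x.

Definition poly_time_Turing_reducible (P P' : problem) : Prop :=
  exists (M : oracle_machine) (q : {poly nat}),
    forall O : seq bool -> seq bool, solves O P' ->
    forall x : instance P,
      computes_within M O (q.[size (encode x)])%R (encode x) (answer x).

(* 1^n 0 followed by the adjacency matrix, row by row. *)
Definition code_graph (n : nat) (G : sgraph 'I_n) : seq bool :=
  nseq n true ++ false :: [seq G i j | i <- enum 'I_n, j <- enum 'I_n].

(* For each vertex of G in turn, the characteristic vector of its list. *)
Definition code_pinning (T : finType) (n : nat) (p : 'I_n -> {set T}) :
    seq bool :=
  [seq h \in p v | v <- enum 'I_n, h <- enum T].

Record graph_instance := GraphInstance {
  gi_order : nat;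
  gi_graph : sgraph 'I_gi_order
}.

Record pinned_instance (T : finType) (H : sgraph T) (r : nat) :=
  PinnedInstance {
    pi_order : nat;
    pi_graph : sgraph 'I_pi_order;
    pi_pin : 'I_pi_order -> {set T};
    pi_restrictive : restrictive H r pi_pin
  }.

(* A number modulo 2 is output as the single bit given by odd. *)
Definition ParityHomsTo (T : finType) (H : sgraph T) : problem :=
  @Problem graph_instance
    (fun x => code_graph (gi_graph x))
    (fun x => [:: odd #|Hom (gi_graph x) H|]).

Definition ParityPinnedHomsTo (T : finType) (H : sgraph T) (r : nat) :
    problem :=
  @Problem (pinned_instance H r)
    (fun x => code_graph (pi_graph x) ++ code_pinning (@pi_pin _ _ _ x))
    (fun x => [:: odd #|Hom_pinned (pi_graph x) H (@pi_pin _ _ _ x)|]).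

(* Codes determine graphs, so an oracle that solves ParityHomsTo H exists and *)
(* a reduction to it does not hold vacuously.                                 *)
Lemma code_graph_inj (n m : nat) (G : sgraph 'I_n) (G' : sgraph 'I_m) :
  code_graph G = code_graph G' ->
  exists e : n = m, forall i j, G i j = G' (cast_ord e i) (cast_ord e j).
Proof.
move=> eqGG'.
have idx k s : index false (nseq k true ++ false :: s) = k.
  by elim: k => //= k ->.
have e : n = m by move: (congr1 (index false) eqGG'); rewrite !idx.
case: m / e G' eqGG' => G' eqGG'; exists erefl => i j.
have := congr1 (drop n.+1) eqGG'; rewrite /code_graph -!cat_rcons.
rewrite !drop_size_cat ?size_rcons ?size_nseq // => eq_pairs.
have eq_rows : [seq [seq G i j | j <- enum 'I_n] | i <- enum 'I_n] =
               [seq [seq G' i j | j <- enum 'I_n] | i <- enum 'I_n].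
  apply: eq_from_flatten_shape => //.
  by rewrite /shape -!map_comp; apply: eq_map => k /=; rewrite !size_map.
rewrite !cast_ord_id.
have /eq_in_map/(_ i (mem_enum _ i)) := eq_rows.
by move/eq_in_map/(_ j (mem_enum _ j)).
Qed.

(* Main.v *)
From HB Require Import structures.
From Stdlib Require Import FunctionalExtensionality.
Require Import Defs.
From mathcomp Require Import all_boot all_order all_fingroup all_algebra.
From mathcomp Require Import all_solvable zify.
(* fingroup and poly shadow [action] and [root]. *)
Import Defs fingraph.

Set Implicit Arguments.
Unset Strict Implicit.
Unset Printing Implicit Defensive.

(** Since [H] has no involution, [Aut H] has odd order by Cauchy's theorem.
    Hence, for a union [S] of orbits, [y] lies in [S] iff the number of pairs of
    [h] in [S] and an injective endomorphism [f] of [H] with [f h = y] is odd.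
    By inclusion-exclusion modulo 2, this number is congruent to the sum, over
    [h] in [S] and over all sets [E] of pairs of distinct vertices, of the
    number of endomorphisms [f] with [f h = y] that are constant on the pairs
    in [E]; these are the homomorphisms to [H] from the quotient of [H] by [E]
    that send the class of [h] to [y].  So restricting a vertex [v] to [S] has
    the same effect, modulo 2, as summing over the graphs obtained by
    identifying [v] with the root of one of these quotients.  At most [r]
    vertices are restricted, so a constant number of queries, each of size
    [n + O(1)], suffices.  Every restricted vertex gets one of [r] slots; the
    choice of gadgets for the slots is hard-wired in the program of the
    machine, which only has to find the restricted vertices and to write the
    adjacency matrices. *)

(** * Counting homomorphisms modulo 2 *)

Lemma card_cancel_in (X Y : finType) (A : {set X}) (B : {set Y})
    (F : X -> Y) (F' : Y -> X) :
  {in A, forall x, F x \in B} -> {in B, forall y, F' y \in A} ->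
  {in A, cancel F F'} -> {in B, cancel F' F} -> #|A| = #|B|.
Proof.
move=> FB F'A FK F'K; rewrite -(card_in_imset (can_in_inj FK)).
apply/eq_card => y; apply/imsetP/idP => [[x xA ->]|yB]; first exact: FB.
by exists (F' y); rewrite ?F'K ?F'A.
Qed.

Section Parity.

Variables (T : finType) (H : sgraph T).

Lemma Aut_graphP (s : {perm T}) :
  reflect (forall x y, H (s x) (s y) = H x y) (s \in Aut_graph H).
Proof.
rewrite inE; apply: (iffP 'forall_forallP) => sH x y; last by rewrite sH.
exact/eqP/sH.
Qed.

Lemma group_set_Aut_graph : group_set (Aut_graph H).
Proof.
apply/group_setP; split=> [|s t /Aut_graphP sH /Aut_graphP tH].
  by apply/Aut_graphP => x y; rewrite !perm1.
by apply/Aut_graphP => x y; rewrite !permM tH sH.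
Qed.

Canonical Aut_graph_group := Group group_set_Aut_graph.

Lemma odd_card_Aut_graph : involution_free H -> odd #|Aut_graph H|.
Proof.
move=> noinv; apply/negPn/negP; rewrite -dvdn2 => /(Cauchy (isT : prime 2)).
by case=> s sA os; apply: noinv; exists s.
Qed.

Lemma perm_hom_Aut (s : {perm T}) :
  (forall x y, H x y -> H (s x) (s y)) -> s \in Aut_graph H.
Proof.
move=> sH; have sXH k x y : H x y -> H ((s ^+ k)%g x) ((s ^+ k)%g y).
  elim: k => [|k IHk] xy; first by rewrite expg0 !perm1.
  by rewrite expgSr !permM sH // IHk.
apply/Aut_graphP => x y; apply/idP/idP => [/(sXH #[s]%g.-1)|]; last exact: sH.
by rewrite -!permM -expgS prednK ?order_gt0 // expg_order !perm1.
Qed.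

Definition Aut_invariant (S : {set T}) : Prop :=
  forall s, s \in Aut_graph H -> forall y, (s y \in S) = (y \in S).

Lemma sum_injective_hom (S : {set T}) (y : T) : Aut_invariant S ->
  \sum_(h in S) \sum_(f : {ffun T -> T} | is_hom H H f && (f h == y))
     injectiveb f = #|Aut_graph H| * (y \in S).
Proof.
move=> Sinv.
under eq_bigr do rewrite big_mkcondr /=.
rewrite exchange_big /=.
have -> : \sum_(f : {ffun T -> T} | is_hom H H f)
     \sum_(h in S) (if f h == y then injectiveb f : nat else 0) =
   \sum_(f : {ffun T -> T} | is_hom H H f && injectiveb f)
     \sum_(h in S) (f h == y).
  rewrite [RHS]big_mkcondr; apply: eq_bigr => f _.
  case: (injectiveb f) => /=; last by rewrite big1 // => h _; rewrite if_same.
  by apply: eq_bigr => h _; case: eqP.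
rewrite (reindex_onto (@pval T) (insubd (1%g : {perm T}))).
  2: by move=> f /andP[_ fi]; have:= val_insubd (1%g : {perm T}) f; rewrite fi.
have homA s : is_hom H H (pval s) = (s \in Aut_graph H).
  apply/'forall_forallP/idP => [sH|/Aut_graphP sH x z].
    by apply: perm_hom_Aut => x z xz; move/implyP: (sH x z); rewrite !pvalE; apply.
  by apply/implyP; rewrite !pvalE sH.
rewrite (eq_bigl (mem (Aut_graph H))) => [|s]; last first.
  by rewrite homA (valP s : injectiveb (pval s)) (valKd _ s) eqxx !andbT.
rewrite -sum_nat_const; apply: eq_bigr => s sA; rewrite -(Sinv _ (groupVr sA)).
have [yS|yS] := boolP (_ \in S).
  rewrite (bigD1 _ yS) /= pvalE permKV eqxx big1 // => h /andP[_ neq].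
   by rewrite (canF_eq (permK s)) (negbTE neq).
rewrite big1 // => h hS; rewrite pvalE (canF_eq (permK s)).
by case: eqP yS => // <-; rewrite hS.
Qed.

Lemma odd_sum (I : finType) (P : pred I) (F : I -> nat) :
  odd (\sum_(i | P i) F i) = \big[addb/false]_(i | P i) odd (F i).
Proof. exact: (big_morph odd oddD). Qed.

Lemma odd_prod (I : finType) (P : pred I) (F : I -> nat) :
  odd (\prod_(i | P i) F i) = [forall (i | P i), odd (F i)].
Proof. by rewrite (big_morph odd oddM (erefl : odd 1 = true)) big_andE. Qed.

Section Quotient.

Variable E : {set T * T}.

Definition glue : rel T := [rel x y | ((x, y) \in E) || ((y, x) \in E)].

Lemma glue_sym : connect_sym glue.
Proof. by apply: sym_connect_sym => x y; rewrite /glue /= orbC. Qed.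

Lemma root_glue_id x : root glue (root glue x) = root glue x.
Proof. exact: (root_root glue_sym). Qed.

Lemma root_glue_const (X : eqType) (f : T -> X) :
  (forall x, x \in E -> f x.1 = f x.2) <-> (forall x, f (root glue x) = f x).
Proof.
split=> [fE x|fr [x y] xy] /=; last first.
  rewrite -(fr x) -(fr y); congr f; apply/(rootP glue_sym).
  by apply: connect1; rewrite /glue /= xy.
have /connectP[s sE ->] := connect_root glue x.
elim: s x sE => //= z s IHs x /andP[xz /IHs ->].
by case/orP: xz => /fE.
Qed.

Definition loopless : bool :=
  [forall u, forall v, H u v ==> (root glue u != root glue v)].

Definition offdiag : bool := [forall x in E, x.1 != x.2].

End Quotient.

(* [None] is the gadget without vertices; [Some (h, E)] is the graph obtained *)
(* from [H] by identifying the pairs in [E], with the class of [h] removed.   *)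
(* The neighbours of that class are the vertices of [gad_att].                *)
Definition gadget : finType := option (T * {set T * T}).

Definition gad_dom (j : gadget) : {set T} :=
  if j is Some (h, E) then
    [set t | (root (glue E) t == t) && (t != root (glue E) h)]
  else set0.

Definition gad_adj (j : gadget) : rel T :=
  if j is Some (h, E) then
    [rel t t' | (t != t') && [exists u, exists v,
       [&& root (glue E) u == t, root (glue E) v == t' & H u v]]]
  else [rel t t' | false].

Definition gad_att (j : gadget) : {set T} :=
  if j is Some (h, E) then
    [set t | [exists u, exists v, [&& root (glue E) u == root (glue E) h,
                                      root (glue E) v == t & H u v]]]
  else set0.

Lemma gad_adj_sym j : symmetric (gad_adj j).
Proof.
case: j => [[h E]|//] t t' /=; rewrite eq_sym; congr andb.
by apply/existsP/existsP => -[u /existsP[v /and3P[ut vt' uv]]]; exists v;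
  apply/existsP; exists u; rewrite ut vt' adj_sym.
Qed.

Lemma gad_adj_irr j : irreflexive (gad_adj j).
Proof. by case: j => [[h E]|//] t /=; rewrite eqxx. Qed.

Definition gad_homs (j : gadget) (Y : {set T}) : {set {ffun T -> T}} :=
  [set g : {ffun T -> T} | [&& [forall (t | t \notin gad_dom j), g t == t],
               [forall t in gad_dom j, forall t' in gad_dom j,
                  gad_adj j t t' ==> H (g t) (g t')]
             & [forall t in gad_dom j :&: gad_att j,
                  forall y in Y, H y (g t)]]].

Lemma gad_homsP j (Y : {set T}) (g : {ffun T -> T}) :
  reflect [/\ forall t, t \notin gad_dom j -> g t = t,
              forall t t', t \in gad_dom j -> t' \in gad_dom j ->
                gad_adj j t t' -> H (g t) (g t')
            & forall t y, t \in gad_dom j -> t \in gad_att j -> y \in Y ->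
                H y (g t)]
          (g \in gad_homs j Y).
Proof.
rewrite inE; apply: (iffP and3P) => -[g1 g2 g3]; split.
- by move=> t tj; apply/eqP/(forall_inP g1).
- move=> t t' tj t'j; apply/implyP.
  by have /forall_inP := forall_inP g2 t tj; apply.
- move=> t y tj ta; have := forall_inP g3 t; rewrite inE tj ta.
  by move=> /(_ isT)/forall_inP; apply.
- by apply/forall_inP => t tj; rewrite g1.
- by do 2!apply/forall_inP => ? ?; apply/implyP; apply: g2.
- by apply/forall_inP => t /setIP[tj ta]; apply/forall_inP => y; apply: g3.
Qed.

Definition glued_homs (h y : T) (E : {set T * T}) : {set {ffun T -> T}} :=
  [set f : {ffun T -> T} | [&& is_hom H H f, f h == y & [forall x in E, f x.1 == f x.2]]].

Lemma homP (V : finType) (G : sgraph V) (f : {ffun V -> T}) :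
  reflect (forall u v, G u v -> H (f u) (f v)) (is_hom G H f).
Proof.
by apply: (iffP 'forall_forallP) => fH u v; [apply/implyP/fH|apply/implyP/fH].
Qed.

Lemma glued_homsP h y E (f : {ffun T -> T}) :
  reflect [/\ forall u v, H u v -> H (f u) (f v), f h = y
            & forall x, f (root (glue E) x) = f x]
          (f \in glued_homs h y E).
Proof.
rewrite inE; apply: (iffP and3P) => -[f1 f2 f3]; split.
- exact/homP.
- exact/eqP.
- by apply/root_glue_const => x /(forall_inP f3)/eqP.
- exact/homP.
- exact/eqP.
- apply/forall_inP => x xE; apply/eqP.
  by move/root_glue_const: f3; apply.
Qed.

Lemma glued_homs_loop h y E : ~~ loopless E -> glued_homs h y E = set0.
Proof.
case/forallPn => u /forallPn[v]; rewrite negb_imply negbK => /andP[uv /eqP e].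
apply/setP => f; rewrite [RHS]inE; apply/glued_homsP => -[fH _ fr].
by have := fH _ _ uv; rewrite -(fr u) -(fr v) e adj_irr.
Qed.

Lemma card_gad_homs h y E : loopless E ->
  #|gad_homs (Some (h, E)) [set y]| = #|glued_homs h y E|.
Proof.
move=> /'forall_forallP lE; set j := Some _; set rho := root (glue E).
have rr x : rho (rho x) = rho x := root_glue_id E x.
have inD t : rho t != rho h -> rho t \in gad_dom j by rewrite inE -/rho rr eqxx.
pose F (g : {ffun T -> T}) := [ffun x => if rho x == rho h then y else g (rho x)].
pose F' (f : {ffun T -> T}) := [ffun t => if t \in gad_dom j then f t else t].
apply: (@card_cancel_in _ _ _ _ F F').
- move=> g /gad_homsP[g1 g2 g3]; apply/glued_homsP; split=> [u v uv||x].
  + have neq : rho u != rho v := implyP (lE u v) uv; rewrite !ffunE.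
    case: ifPn => uh; case: ifPn => vh.
    * by rewrite (eqP uh) (eqP vh) eqxx in neq.
    * apply: g3; rewrite ?inD ?set11 // inE; apply/existsP; exists u.
      by apply/existsP; exists v; rewrite uh eqxx.
    * rewrite adj_sym; apply: g3; rewrite ?inD ?set11 // inE.
      by apply/existsP; exists v; apply/existsP; exists u; rewrite vh eqxx adj_sym.
    * apply: g2; rewrite ?inD //= neq; apply/existsP; exists u.
      by apply/existsP; exists v; rewrite !eqxx.
  + by rewrite ffunE eqxx.
  + by rewrite !ffunE rr.
- move=> f /glued_homsP[f1 f2 f3]; apply/gad_homsP; split=> [t tj|t t' tj t'j|t z tj ta].
  + by rewrite ffunE (negbTE tj).
  + rewrite !ffunE tj t'j /= => /andP[_ /existsP[u /existsP[v]]].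
    by case/and3P => /eqP <- /eqP <- uv; rewrite !f3 f1.
  + move/set1P->; move: ta; rewrite ffunE tj inE.
    case/existsP=> u /existsP[v /and3P[/eqP uh /eqP <- uv]].
    by rewrite f3 -f2 -(f3 h) -uh f3 f1.
- move=> g /gad_homsP[g1 _ _]; apply/ffunP => t; rewrite ffunE.
  case: ifPn => [|/g1 -> //]; rewrite inE => /andP[/eqP rt th].
  by rewrite ffunE [rho t]rt (negbTE th).
- move=> f /glued_homsP[_ f2 f3]; apply/ffunP => x; rewrite ffunE.
  case: ifPn => [/eqP xh|xh]; first by rewrite -f2 -f3 -[RHS]f3 -/rho xh.
  by rewrite ffunE inD ?f3.
Qed.

(* Modulo 2 the sum over all sets of pairs is an inclusion-exclusion that     *)
(* keeps the injective maps only.                                             *)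
Lemma odd_sum_glue (f : {ffun T -> T}) :
  odd (\sum_(E : {set T * T}) (offdiag E && [forall x in E, f x.1 == f x.2]))
  = injectiveb f.
Proof.
pose b (x : T * T) : bool := (x.1 != x.2) && (f x.1 == f x.2).
have -> : \sum_(E : {set T * T})
    (offdiag E && [forall x in E, f x.1 == f x.2]) = \prod_x (b x + 1).
  rewrite bigA_distr; apply: eq_bigr => E _.
  have -> : \prod_x (if x \in E then nat_of_bool (b x) else 1) =
      [forall x in E, b x].
    rewrite -big_mkcond /=.
    rewrite -big_andE; apply/esym/(big_morph nat_of_bool) => // x z.
    by rewrite mulnb.
  congr nat_of_bool; apply/andP/forall_inP => [[o c] x xE|bE].
    by rewrite /b (forall_inP o) // (forall_inP c).
  by split; apply/forall_inP => x /bE/andP[].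
rewrite odd_prod; apply/forall_inP/injectiveP => [fb x z fxz|fi [x z] _].
  have := fb (x, z) isT; rewrite oddD oddb addbT /b /= fxz eqxx andbT negbK.
  exact: eqP.
by rewrite oddD oddb addbT /b /= (inj_eq fi) andNb.
Qed.

Definition gad_coef (o : option {set T}) (j : gadget) : bool :=
  match o, j with
  | None, None => true
  | Some X, Some (h, E) => [&& h \in X, offdiag E & loopless E]
  | _, _ => false
  end.

Lemma gad_parity (S : {set T}) y : involution_free H -> Aut_invariant S ->
  odd (\sum_j gad_coef (Some S) j * #|gad_homs j [set y]|) = (y \in S).
Proof.
move=> noinv Sinv.
rewrite (bigID isSome) /= [X in _ + X]big1 ?addn0; last by case.
rewrite (reindex_omap Some id) => [|[]//].
rewrite (eq_bigl predT) => [|x]; last by rewrite eqxx.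
rewrite (eq_bigr (fun x => gad_coef (Some S) (Some (x.1, x.2)) *
  #|gad_homs (Some (x.1, x.2)) [set y]|)) => [|[]//].
rewrite -(pair_bigA _ (fun h E =>
  gad_coef (Some S) (Some (h, E)) * #|gad_homs (Some (h, E)) [set y]|)) /=.
transitivity (odd (\sum_(h in S)
    \sum_(f : {ffun T -> T} | is_hom H H f && (f h == y)) injectiveb f)).
  rewrite [in RHS]big_mkcond !odd_sum; apply: eq_bigr => h _.
  case: (h \in S); last by rewrite big1.
  rewrite [in RHS]odd_sum; under [in RHS]eq_bigr do rewrite oddb -odd_sum_glue.
  rewrite -odd_sum exchange_big; congr odd; apply: eq_bigr => E _ /=.
  transitivity (offdiag E * #|glued_homs h y E|).
    case: (boolP (loopless E)) => lE; last first.
      by rewrite glued_homs_loop ?cards0 // andbF muln0.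
    by rewrite andbT card_gad_homs.
  rewrite -sum1_card big_distrr /= [RHS]big_mkcond [LHS]big_mkcond.
  apply: eq_bigr => f _; rewrite inE.
  by case: (is_hom H H f); case: (f h == y) => //=; case: (offdiag E); case: [forall _ in _, _].
by rewrite sum_injective_hom // oddM oddb odd_card_Aut_graph.
Qed.

Section Attach.

Variables (r n : nat) (G : sgraph 'I_n).
Variable mark : 'I_n -> option 'I_r.

Definition meets (o m : option 'I_r) : bool :=
  if o is Some k then m == Some k else false.

Section Graph.

Variables (C : nat) (X : sgraph 'I_C) (att : 'I_C -> option 'I_r).

Definition attach_rel : rel 'I_(n + C) := fun i j =>
  match split i, split j with
  | inl u, inl v => G u v
  | inl u, inr c | inr c, inl u => meets (att c) (mark u)
  | inr c, inr c' => X c c'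
  end.

Lemma attach_sym : symmetric attach_rel.
Proof.
move=> i j; rewrite /attach_rel.
by case: (split i) => u; case: (split j) => v //; rewrite adj_sym.
Qed.

Lemma attach_irr : irreflexive attach_rel.
Proof. by move=> i; rewrite /attach_rel; case: (split i) => u; rewrite adj_irr. Qed.

Definition attach : sgraph 'I_(n + C) := SGraph attach_sym attach_irr.

Definition attach_homs (f : {ffun 'I_n -> T}) : {set {ffun 'I_C -> T}} :=
  [set g | is_hom X H g &
    [forall u, forall c, meets (att c) (mark u) ==> H (f u) (g c)]].

Lemma card_Hom_attach :
  #|Hom attach H| = \sum_(f in Hom G H) #|attach_homs f|.
Proof.
transitivity #|[set x : {ffun 'I_n -> T} * {ffun 'I_C -> T} |
                 (x.1 \in Hom G H) && (x.2 \in attach_homs x.1)]|; last first.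
  rewrite -sum1_card.
  rewrite (eq_bigl (fun x => (x.1 \in Hom G H) && (x.2 \in attach_homs x.1)));
    last by move=> x; rewrite inE.
  rewrite -(pair_big_dep (fun f => f \in Hom G H)
    (fun f g => g \in attach_homs f) (fun _ _ => 1)) /=; apply: eq_bigr => f _.
  by rewrite sum1_card.
apply: (@card_cancel_in _ _ _ _
  (fun f : {ffun 'I_(n + C) -> T} =>
     ([ffun u => f (lshift C u)], [ffun c => f (rshift n c)]))
  (fun x => [ffun i => match split i with inl u => x.1 u | inr c => x.2 c end])).
- move=> f; rewrite !inE /= => /homP fH; apply/and3P; split.
  + apply/homP => u v uv; rewrite !ffunE; apply: fH.
    by rewrite /= /attach_rel !(unsplitK (inl _)).
  + apply/homP => u v uv; rewrite !ffunE; apply: fH.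
    by rewrite /= /attach_rel !(unsplitK (inr _)).
  + apply/'forall_forallP => u c; apply/implyP => m; rewrite !ffunE; apply: fH.
    by rewrite /= /attach_rel (unsplitK (inl u)) (unsplitK (inr c)).
- case=> f g; rewrite !inE /= => /and3P[/homP fH /homP gH /'forall_forallP fg].
  apply/homP => i j; rewrite /= /attach_rel !ffunE.
  case: (split i) => u; case: (split j) => v /=.
  + exact: fH.
  + exact/implyP.
  + by move=> m; rewrite adj_sym; move: m; apply/implyP.
  + exact: gH.
- move=> f _; apply/ffunP => i; rewrite ffunE /= -{2}(splitK i).
  by case: (split i) => u; rewrite ffunE.
- case=> f g _; congr pair; apply/ffunP => u; rewrite !ffunE.
    by rewrite (unsplitK (inl u)).
  by rewrite (unsplitK (inr u)).
Qed.

End Graph.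

Section Extension.

Variable d : {ffun 'I_r -> gadget}.

Definition ext_dom : {set 'I_r * T} := [set x | x.2 \in gad_dom (d x.1)].

Definition ext_order := #|ext_dom|.

Definition ext_rel : rel 'I_ext_order := fun c c' =>
  let x := enum_val c in let x' := enum_val c' in
  (x.1 == x'.1) && gad_adj (d x.1) x.2 x'.2.

Lemma ext_sym : symmetric ext_rel.
Proof.
move=> c c'; rewrite /ext_rel eq_sym; case: eqP => //= ->.
exact: gad_adj_sym.
Qed.

Lemma ext_irr : irreflexive ext_rel.
Proof. by move=> c; rewrite /ext_rel gad_adj_irr andbF. Qed.

Definition ext_graph : sgraph 'I_ext_order := SGraph ext_sym ext_irr.

Definition ext_att (c : 'I_ext_order) : option 'I_r :=
  let x := enum_val c in if x.2 \in gad_att (d x.1) then Some x.1 else None.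

Lemma card_attach_homs f : #|attach_homs ext_graph ext_att f| =
  \prod_k #|gad_homs (d k) [set f v | v in [set v | mark v == Some k]]|.
Proof.
pose Y k := [set f v | v in [set v | mark v == Some k]].
transitivity #|family (fun k => mem (gad_homs (d k) (Y k)))|; last first.
  by rewrite card_family foldrE big_map big_enum.
rewrite -[RHS]cardsE.
have valD (c : 'I_ext_order) : (enum_val c).2 \in gad_dom (d (enum_val c).1).
  by have := enum_valP c; rewrite inE.
have cD k t : t \in gad_dom (d k) -> {c : 'I_ext_order | enum_val c = (k, t)}.
  move=> td; have kt : (k, t) \in ext_dom by rewrite inE.
  by exists (enum_rank_in kt (k, t)); rewrite enum_rankK_in.
pose F (g : {ffun 'I_ext_order -> T}) : {ffun 'I_r -> {ffun T -> T}} :=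
  [ffun k => [ffun t => if [pick c | enum_val c == (k, t)] is Some c
                        then g c else t]].
pose F' (gg : {ffun 'I_r -> {ffun T -> T}}) : {ffun 'I_ext_order -> T} :=
  [ffun c => gg (enum_val c).1 (enum_val c).2].
have FE g c : F g (enum_val c).1 (enum_val c).2 = g c.
  rewrite !ffunE; case: pickP => [c'|/(_ c)]; last by rewrite -surjective_pairing eqxx.
  by rewrite -surjective_pairing => /eqP/enum_val_inj ->.
have FN g k t : t \notin gad_dom (d k) -> F g k t = t.
  move=> td; rewrite !ffunE; case: pickP => // c /eqP ct.
  by have := valD c; rewrite ct (negbTE td).
apply: (@card_cancel_in _ _ _ _ F F').
- move=> g; rewrite inE => /andP[/homP gH /'forall_forallP gf].
  rewrite inE; apply/familyP => k; apply/gad_homsP; split=> [t|t t' td t'd tt'|t y td ta].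
  + exact: FN.
  + have [c ec] := cD _ _ td; have [c' ec'] := cD _ _ t'd.
    have := FE g c; have := FE g c'; rewrite ec ec' /= => -> ->; apply: gH.
    by rewrite /= /ext_rel ec ec' eqxx.
  + case/imsetP=> v; rewrite inE => mv ->; have [c ec] := cD _ _ td.
    have := FE g c; rewrite ec /= => ->; apply: (implyP (gf v c)).
    by rewrite /ext_att ec /= ta.
- move=> gg; rewrite inE => /familyP ggH; rewrite inE; apply/andP; split.
    apply/homP => c c' /andP[/eqP e cc']; rewrite !ffunE -e.
    have [_ gH _] := gad_homsP _ _ _ (ggH (enum_val c).1).
    by apply: gH => //; rewrite e.
  apply/'forall_forallP => v c; rewrite /ext_att ffunE.
  case: ifP => //= ta; apply/implyP => mv.
  have [_ _ gH] := gad_homsP _ _ _ (ggH (enum_val c).1).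
  by apply: gH => //; apply: imset_f; rewrite inE.
- by move=> g _; apply/ffunP => c; rewrite ffunE FE.
- move=> gg; rewrite inE => /familyP ggH; apply/ffunP => k; apply/ffunP => t.
  have [gN _ _] := gad_homsP _ _ _ (ggH k).
  case: (boolP (t \in gad_dom (d k))) => td; last by rewrite FN ?gN.
  by have [c ec] := cD _ _ td; have := FE (F' gg) c; rewrite ec /= => ->; rewrite ffunE ec.
Qed.

End Extension.

Variables (p : 'I_n -> {set T}) (cell : {ffun 'I_r -> option {set T}}).

Hypotheses (noinv : involution_free H) (p_inv : forall v, Aut_invariant (p v)).
Hypothesis mark_None : forall v, mark v = None -> p v = [set: T].
Hypothesis mark_Some : forall v k, mark v = Some k -> cell k = Some (p v).
Hypothesis mark_inj : forall u v k, mark u = Some k -> mark v = Some k -> u = v.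
Hypothesis cell_Some : forall k, cell k != None -> exists v, mark v = Some k.

Definition ext_coef (d : {ffun 'I_r -> gadget}) : bool :=
  [forall k, gad_coef (cell k) (d k)].

Lemma parity_attach :
  odd #|Hom_pinned G H p| =
  odd (\sum_d ext_coef d * #|Hom (attach (ext_graph d) (@ext_att d)) H|).
Proof.
under eq_bigr do rewrite card_Hom_attach big_distrr /=.
rewrite exchange_big /= -sum1_card.
rewrite (eq_bigl (fun f => (f \in Hom G H) && [forall v, f v \in p v])); last first.
  by move=> f; rewrite !inE.
rewrite big_mkcondr !odd_sum; apply: eq_bigr => f _.
pose Y k := [set f v | v in [set v | mark v == Some k]].
have -> : \sum_(d : {ffun 'I_r -> gadget})
      ext_coef d * #|attach_homs (ext_graph d) (@ext_att d) f| =
    \prod_k \sum_j gad_coef (cell k) j * #|gad_homs j (Y k)|.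
  rewrite bigA_distr_bigA; apply: eq_bigr => d _.
  rewrite card_attach_homs big_split /=; congr (_ * _).
  have -> : ext_coef d = \big[andb/true]_k gad_coef (cell k) (d k).
    by rewrite big_andE.
  apply: (big_morph nat_of_bool) => // x z.
  by rewrite mulnb.
have slot v k : mark v = Some k ->
    odd (\sum_j gad_coef (cell k) j * #|gad_homs j (Y k)|) = (f v \in p v).
  move=> mv; rewrite (mark_Some mv) -(gad_parity _ noinv (p_inv v)).
  suff -> : Y k = [set f v] by [].
  apply/setP => y; rewrite inE; apply/imsetP/eqP => [[u]|->].
    by rewrite inE => /eqP mu ->; rewrite (mark_inj mu mv).
  by exists v => //; rewrite inE mv.
rewrite odd_prod; transitivity [forall v, f v \in p v].
  by case: [forall v, _].
apply/forallP/forall_inP => [fp k _|oddk v].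
  have [ck|/cell_Some[v mv]] := eqVneq (cell k) None; last by rewrite (slot v).
  rewrite ck (bigD1 None) //= big1 ?addn0; last by case.
  rewrite mul1n (_ : gad_homs _ _ = [set [ffun t => t]]) ?cards1 //.
  apply/setP => g; apply/gad_homsP/set1P => [[g1 _ _]|->]; last first.
    by split=> [t _|t t'|t y]; rewrite ?inE ?ffunE.
  by apply/ffunP => t; rewrite ffunE g1 ?inE.
case mv: (mark v) => [k|]; last by rewrite mark_None ?inE.
by rewrite -(slot _ _ mv) oddk.
Qed.

End Attach.

End Parity.

(** * Structured programs for oracle machines *)

Variant tapename := Tin | Tqry | Tout | Trow | Tcol | Tcell.

Definition nat_of_tapename i :=
  match i with Tin => 0 | Tqry => 1 | Tout => 2 | Trow => 3 | Tcol => 4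
  | Tcell => 5 end.

Definition tapename_of_nat n :=
  nth Tin [:: Tin; Tqry; Tout; Trow; Tcol; Tcell] n.

Lemma nat_of_tapenameK : cancel nat_of_tapename tapename_of_nat.
Proof. by case. Qed.

HB.instance Definition _ := Countable.copy tapename (can_type nat_of_tapenameK).

Lemma tapename_enumP :
  Finite.axiom [:: Tin; Tqry; Tout; Trow; Tcol; Tcell].
Proof. by case. Qed.

HB.instance Definition _ := isFinite.Build tapename tapename_enumP.

Section Programs.

Variables (A : finType) (O : seq bool -> seq bool).

Notation sym := (symbol A).
Notation tps := (tapename -> tape A).
Implicit Types (t : tape A) (a : tps).

Inductive prog :=
  | Do of ((tapename -> sym) -> tapename -> sym * dir)
  | Query
  | Seq of prog & prog
  | While of ((tapename -> sym) -> bool) & prog.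

Fixpoint point (p : prog) : finType :=
  match p with
  | Do _ | Query => unit
  | Seq p q => (point p + point q)%type
  | While _ p => option (point p)
  end.

Fixpoint entry (p : prog) : point p :=
  match p with
  | Do _ => tt
  | Query => tt
  | Seq p q => inl (entry p)
  | While _ p => None
  end.

Definition act_map (Q Q' : finType) (h : Q -> Q')
    (x : action A Q tapename) : action A Q' tapename :=
  match x with
  | Halt => Halt A Q' tapename
  | Ask q => Ask A tapename (h q)
  | Act q f => Act (h q) f
  end.

(* The target [None] is the exit of the program. *)
Fixpoint next (p : prog) :
    point p -> (tapename -> sym) -> action A (option (point p)) tapename :=
  match p with
  | Do f => fun _ s => Act None (f s)
  | Query => fun _ _ => Ask A tapename None
  | Seq p q => fun x s =>
      match x with
      | inl y => act_map (fun z => Some (if z is Some y' then inl y'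
                                         else inr (entry q))) (next y s)
      | inr y => act_map (omap inr) (next y s)
      end
  | While b p => fun x s =>
      match x with
      | None => Act (if b s then Some (Some (entry p)) else None)
                    (fun i => (s i, Stay))
      | Some y => act_map Some (next y s)
      end
  end.

Definition machine (p : prog) : oracle_machine :=
  @OracleMachine A (option (point p)) tapename Tin Tqry Tout (Some (entry p))
    (fun q s => if q is Some x then next x s else Halt A _ tapename).

Definition perform (Q : finType) (x : action A Q tapename) (u : tps) :
    option (Q * tps) :=
  match x with
  | Halt => None
  | Ask q => Some (q, fun i => if i == Tqry
               then tape_of_bits A (O (bits_of_tape (u i))) else u i)
  | Act q f => Some (q, fun i => move (f i).2 (write (f i).1 (u i)))
  end.

Lemma perform_act_map (Q Q' : finType) (h : Q -> Q') x u :
  perform (act_map h x) u = omap (fun z => (h z.1, z.2)) (perform x u).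
Proof. by case: x. Qed.

Inductive run (p : prog) : nat -> point p -> tps -> tps -> Prop :=
  | run_exit x u v :
      perform (next x (fun i => read (u i))) u = Some (None, v) ->
      run 1 x u v
  | run_step m x y u v w :
      perform (next x (fun i => read (u i))) u = Some (Some y, v) ->
      run m y v w -> run m.+1 x u w.

Lemma run_seqr p q m (x : point q) u v : run m x u v ->
  @run (Seq p q) m (inr x) u v.
Proof.
elim=> [{}x {}u {}v|{}m {}x y {}u {}v w] E; last move=> _; [left|apply: run_step];
  by rewrite /= perform_act_map E.
Qed.

Lemma run_seq p q m n x u v w : run m x u v -> run n (entry q) v w ->
  @run (Seq p q) (m + n) (inl x) u w.
Proof.
move=> R; elim: R w => [{}x {}u {}v E|{}m {}x y {}u {}v w' E _ IH] w R.
  rewrite add1n; apply: run_step (run_seqr p R).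
  by rewrite /= perform_act_map E.
rewrite addSn; apply: run_step (IH _ R).
by rewrite /= perform_act_map E.
Qed.

Lemma run_while b p m n x u v w : run m x u v ->
  @run (While b p) n None v w -> @run (While b p) (m + n) (Some x) u w.
Proof.
move=> R; elim: R w => [{}x {}u {}v E|{}m {}x y {}u {}v w' E _ IH] w R.
  by rewrite add1n; apply: run_step R; rewrite /= perform_act_map E.
by rewrite addSn; apply: run_step (IH _ R); rewrite /= perform_act_map E.
Qed.

Lemma run_halts p m x u v : run m x u v ->
  forall n, m <= n ->
  @halts_within (machine p) O n (Config (M := machine p) (Some x) u)
    (Config (M := machine p) None v).
Proof.
elim=> [{}x {}u {}v|{}m {}x y {}u {}v w] E => [|_ IH] [//|n] lemn /=;
  rewrite /step /=; move: E; case: (next _ _) => //=.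
- by move=> q [-> <-]; case: n {lemn}.
- by move=> q f [-> <-]; case: n {lemn}.
- by move=> q [-> E]; rewrite E; apply: IH.
- by move=> q f [-> E]; rewrite E; apply: IH.
Qed.

Definition teq t t' : Prop :=
  nth None t.1 =1 nth None t'.1 /\ nth None t.2 =1 nth None t'.2.

Lemma teq_refl t : teq t t. Proof. by []. Qed.

Lemma teq_sym t t' : teq t t' -> teq t' t.
Proof. by case=> e1 e2; split=> k; rewrite ?e1 ?e2. Qed.

Lemma teq_trans t2 t1 t3 : teq t1 t2 -> teq t2 t3 -> teq t1 t3.
Proof. by case=> e1 e2 [f1 f2]; split=> k; rewrite ?e1 ?e2 ?f1 ?f2. Qed.

Lemma teq_read t t' : teq t t' -> read t = read t'.
Proof. by case=> _ /(_ 0); rewrite !nth0. Qed.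

Lemma nth_behead_eq (s s' : seq sym) :
  nth None s =1 nth None s' -> nth None (behead s) =1 nth None (behead s').
Proof. by move=> e k; rewrite !nth_behead. Qed.

Lemma teq_step t t' s d :
  teq t t' -> teq (move d (write s t)) (move d (write s t')).
Proof.
case=> e1 e2; have h1 : head None t.1 = head None t'.1 by rewrite -!nth0.
by case: d; split=> //=; first [exact: nth_behead_eq
  |case=> [|[|k]] //=; apply: nth_behead_eq|case=> [|k] //=; apply: nth_behead_eq|idtac].
Qed.

Lemma leading_bits_eq (s s' : seq sym) :
  nth None s =1 nth None s' -> leading_bits s = leading_bits s'.
Proof.
elim: s s' => [|x s IH] [|x' s'] e //=; first by have:= e 0 => /= <-.
  by have:= e 0 => /= ->.
have:= e 0 => /= ->; case: x' {e}(fun k => e k.+1) => [[b|//]|//] e.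
by congr (_ :: _); apply: IH.
Qed.

Lemma teq_bits t t' : teq t t' -> bits_of_tape t = bits_of_tape t'.
Proof. by case=> _; apply: leading_bits_eq. Qed.

Definition Rep a u : Prop := forall i, teq (a i) (u i).

(* Contents of tapes are specified up to trailing blanks, and [n] is only an  *)
(* upper bound on the number of steps.                                        *)
Definition tr p n a a' : Prop := forall u, Rep a u ->
  exists m v, [/\ m <= n, run m (entry p) u v & Rep a' v].

Lemma Rep_read a u : Rep a u -> (fun i => read (u i)) = (fun i => read (a i)).
Proof. by move=> E; apply: functional_extensionality => i; rewrite (teq_read (E i)). Qed.

Lemma tr_weak p n a a' n' b b' :
  tr p n a a' -> n <= n' -> (forall i, teq (b i) (a i)) ->
  (forall i, teq (a' i) (b' i)) -> tr p n' b b'.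
Proof.
move=> P le E E' u R.
have [i|m [v [lem r R']]] := P u; first exact: teq_trans (teq_sym (E i)) (R i).
exists m, v; split=> // [|i]; first exact: leq_trans le.
exact: teq_trans (teq_sym (E' i)) (R' i).
Qed.

Lemma tr_do f a a' :
  (forall i, teq (move (f (fun i => read (a i)) i).2
               (write (f (fun i => read (a i)) i).1 (a i))) (a' i)) ->
  tr (Do f) 1 a a'.
Proof.
move=> E u R; exists 1; eexists; split; first by [].
  by apply: run_exit => /=; reflexivity.
move=> i; rewrite (Rep_read R); apply: teq_trans (teq_sym (E i)) _.
exact: teq_step.
Qed.

Lemma tr_query a a' :
  (forall i, teq (if i == Tqry then tape_of_bits A (O (bits_of_tape (a i)))
                  else a i) (a' i)) ->
  tr Query 1 a a'.
Proof.
move=> E u R; exists 1; eexists; split; first by [].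
  by apply: run_exit => /=; reflexivity.
move=> i; apply: teq_trans (teq_sym (E i)) _ => /=.
by rewrite (teq_bits (R i)); case: eqP.
Qed.

Lemma tr_seq p q m n a b c : tr p m a b -> tr q n b c -> tr (Seq p q) (m + n) a c.
Proof.
move=> P Q u /P[m' [v [lem rp /Q[n' [w [len rq R]]]]]].
by exists (m' + n'), w; split=> //; [apply: leq_add|apply: run_seq rq].
Qed.

Lemma teq_keep t d : d = Stay -> teq (move d (write (read t) t)) t.
Proof. by move=> ->; split=> //; case: t => l [|x r] [|k] //=; rewrite nth_nil. Qed.

Lemma tr_while_false b p a : ~~ b (fun i => read (a i)) -> tr (While b p) 1 a a.
Proof.
move=> nb u R; exists 1; eexists; split; first by [].
  by apply: run_exit; rewrite /= (Rep_read R) (negbTE nb); reflexivity.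
move=> i; apply: teq_trans (R i) (teq_sym _); exact: (@teq_keep _ Stay).
Qed.

Lemma tr_while_true (b : _ -> bool) p m n a a1 a2 : b (fun i => read (a i)) ->
  tr p m a a1 -> tr (While b p) n a1 a2 -> tr (While b p) (1 + m + n) a a2.
Proof.
move=> tb P W u R.
have R0 : Rep a (fun i => move Stay (write (read (u i)) (u i))).
  by move=> i; apply: teq_trans (R i) (teq_sym _); apply: teq_keep.
have [m' [v [lem rp /W[n' [w [len rw R']]]]]] := P _ R0.
exists (1 + m' + n'), w; split=> //; first by rewrite !leq_add.
rewrite -addnA add1n; apply: run_step (run_while rp rw).
by rewrite /= (Rep_read R) tb.
Qed.

End Programs.

Section Rules.

Variables (A : finType) (O : seq bool -> seq bool).

Notation sym := (symbol A).
Notation tps := (tapename -> tape A).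
Notation tr := (@tr A O).
Implicit Types (t : tape A) (a : tps).

Definition keep (s : tapename -> sym) (i : tapename) : sym * dir := (s i, Stay).

Definition seqs (ps : seq (prog A)) : prog A :=
  foldr (fun p q => Seq p q) (Do keep) ps.

Lemma tr_keep a : tr (Do keep) 1 a a.
Proof. by apply: tr_do => i; apply: teq_keep. Qed.

Lemma tr_seqs (X : Type) (P : X -> prog A) k (St : seq X -> seq X -> tps) xs :
  (forall done x rest, xs = done ++ x :: rest ->
     tr (P x) k (St done (x :: rest)) (St (rcons done x) rest)) ->
  tr (seqs [seq P x | x <- xs]) (size xs * k + 1) (St [::] xs) (St xs [::]).
Proof.
move=> IH.
suff gen done rest : xs = done ++ rest ->
    tr (seqs [seq P x | x <- rest]) (size rest * k + 1) (St done rest) (St xs [::]).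
  exact: gen.
elim: rest done => [|x rest IHr] done e /=.
  by rewrite e cats0 mul0n; apply: tr_keep.
rewrite mulSn -addnA; apply: tr_seq (IH _ _ _ e) (IHr _ _).
by rewrite e cat_rcons.
Qed.

Lemma tr_for (X : Type) (b : _ -> bool) p k (St : seq X -> seq X -> tps) xs :
  (forall done x rest, xs = done ++ x :: rest ->
     b (fun i => read (St done (x :: rest) i)) /\
     tr p k (St done (x :: rest)) (St (rcons done x) rest)) ->
  ~~ b (fun i => read (St xs [::] i)) ->
  tr (While b p) (size xs * k.+1 + 1) (St [::] xs) (St xs [::]).
Proof.
move=> IH nb.
suff gen done rest : xs = done ++ rest ->
    tr (While b p) (size rest * k.+1 + 1) (St done rest) (St xs [::]).
  exact: gen.
elim: rest done => [|x rest IHr] done e /=.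
  by rewrite cats0 in e; rewrite -e mul0n; apply: tr_while_false.
have [tb tp] := IH _ _ _ e.
rewrite mulSn -addnA -[k.+1]add1n; apply: (tr_while_true tb tp (IHr _ _)).
by rewrite e cat_rcons.
Qed.

Definition upd a i t : tps := fun j => if j == i then t else a j.

Lemma upd_same a i t : upd a i t i = t.
Proof. by rewrite /upd eqxx. Qed.

Definition shift d i (s : tapename -> sym) (j : tapename) : sym * dir :=
  (s j, if j == i then d else Stay).

Lemma tr_shift d i a t :
  a i = t -> tr (Do (shift d i)) 1 a (upd a i (move d (write (read t) t))).
Proof.
move=> <-; apply: tr_do => j; rewrite /upd /=.
by have [->|_] := eqVneq j i => //; apply: teq_keep.
Qed.

Definition rewind i : prog A :=
  Seq (Do (shift MoveL i))
    (Seq (While (fun s => s i) (Do (shift MoveL i))) (Do (shift MoveR i))).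

(* If [w] is empty, the blank cell to the left of [r] is scanned. *)
Definition at_last (w r : seq sym) : tape A :=
  (behead (rev w), head None (rev w) :: r).

Lemma at_last_rcons w x r : at_last (rcons w x) r = (rev w, x :: r).
Proof. by rewrite /at_last rev_rcons. Qed.

Lemma teq_blank (r : seq sym) : teq ([:: None], r) ([::], r).
Proof. by split=> // -[|[]]. Qed.

Lemma tr_rewind i a w r : all isSome w -> a i = (rev w, r) ->
  tr (rewind i) (2 * size w + 3) a (upd a i ([::], w ++ r)).
Proof.
move=> ws ai.
have s1 : tr (Do (shift MoveL i)) 1 a (upd a i (at_last w r)).
  apply: tr_weak (tr_shift MoveL ai) _ _ _ => // j; rewrite /upd.
  case: (j == i) => //; split=> // -[|k] //=.
  by case: r {ai} k => [|x r] [|k] //=; rewrite nth_nil.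
have s2 : tr (While (fun s => s i) (Do (shift MoveL i))) (2 * size w + 1)
    (upd a i (at_last w r)) (upd a i (at_last [::] (w ++ r))).
  elim/last_ind: w ws r {ai s1} => [|w x IHw] ws r /=.
    by apply: tr_while_false; rewrite /upd eqxx.
  rewrite all_rcons in ws; case/andP: ws => xs ws.
  have := IHw ws (x :: r); rewrite cat_rcons => IH.
  have s0 : tr (Do (shift MoveL i)) 1 (upd a i (at_last (rcons w x) r))
      (upd a i (at_last w (x :: r))).
    apply: tr_weak (tr_shift MoveL (upd_same _ _ _)) _ _ _ => //.
    by move=> j; rewrite /upd; case: (j == i); rewrite // at_last_rcons.
  apply: tr_weak (tr_while_true _ s0 IH) _ _ _ => //.
    by rewrite /upd eqxx at_last_rcons.
  by rewrite size_rcons; lia.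
apply: tr_weak (tr_seq s1 (tr_seq s2 (tr_shift MoveR (upd_same _ _ _)))) _ _ _.
- by lia.
- by [].
- by move=> j; rewrite /upd; case: (j == i) => //; apply: teq_blank.
Qed.

End Rules.

(** * The reduction *)

Section Marks.

Variables (T : finType) (r : nat).

Definition cellT : finType := {ffun 'I_r -> option {set T}}.

Definition mark_step (c : cellT) (B : {set T}) : option 'I_r * cellT :=
  if B == [set: T] then (None, c)
  else if [pick k | c k == None] is Some k then
    (Some k, [ffun i => if i == k then Some B else c i])
  else (None, c).

Fixpoint marks (Bs : seq {set T}) : seq (option 'I_r) * cellT :=
  if Bs is B :: Bs' then
    let x := marks Bs' in let y := mark_step x.2 B in (y.1 :: x.1, y.2)
  else ([::], [ffun=> None]).

Lemma marks_spec (V : finType) (p : V -> {set T}) (us : seq V) : uniq us ->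
  count (fun v => p v != [set: T]) us <= r ->
  exists mk : V -> option 'I_r, let c := (marks [seq p v | v <- us]).2 in
  [/\ (marks [seq p v | v <- us]).1 = [seq mk v | v <- us],
      {in us, forall v, mk v = None -> p v = [set: T]},
      {in us, forall v k, mk v = Some k -> c k = Some (p v)},
      {in us &, forall u v k, mk u = Some k -> mk v = Some k -> u = v}
    & (forall k, c k != None -> exists2 v, v \in us & mk v = Some k) /\
      #|[set k | c k != None]| <= count (fun v => p v != [set: T]) us].
Proof.
elim: us => [|v us IH] /=.
  exists (fun=> None); split=> //; split=> [k|]; first by rewrite ffunE.
  by rewrite leqn0 cards_eq0; apply/eqP/setP => k; rewrite !inE ffunE.
case/andP=> vus uus cnt; have [|mk] := IH uus; first by apply: leq_trans cnt; apply: leq_addl.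
set c := (marks _).2 => /= -[e1 e2 e3 e4 [e5 e6]].
rewrite /mark_step e1; case: (eqVneq (p v)) => [pv|pv] /=.
  exists (fun u => if u == v then None else mk u); rewrite eqxx; split.
  - congr cons; apply/eq_in_map => u uu; case: eqP => // uv.
    by rewrite -uv uu in vus.
  - by move=> u; rewrite inE; case: eqP => [-> //|_] /=; apply: e2.
  - by move=> u; rewrite inE; case: eqP => [//|_] /=; apply: e3.
  - by move=> u w; rewrite !inE; case: eqP => [//|_] /= uu;
      case: eqP => [//|_] /= wu k; apply: e4.
  - split=> [k /e5[u uu mu]|]; last by rewrite add0n.
    exists u; first by rewrite inE uu orbT.
    by case: eqP => // uv; rewrite -uv uu in vus.
case: pickP => [k /eqP ck|full]; last first.
  suff /eqP : #|[set k | c k != None]| = r.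
    rewrite eqn_leq => /andP[_ ler]; rewrite pv add1n in cnt;
      by have := leq_trans cnt (leq_trans ler e6); rewrite ltnn.
  rewrite -[RHS]card_ord -cardsT; apply: eq_card => k.
  by rewrite !inE full.
exists (fun u => if u == v then Some k else mk u); rewrite eqxx /=.
have muk u : u \in us -> mk u <> Some k.
  by move=> uu /(e3 _ uu); rewrite ck.
split.
- congr cons; apply/eq_in_map => u uu; case: eqP => // uv.
  by rewrite -uv uu in vus.
- by move=> u; rewrite inE; case: eqP => //= _; apply: e2.
- move=> u; rewrite inE; case: eqP => [-> _ k' [<-]|_] /=; first by rewrite ffunE eqxx.
  move=> uu k' mu; rewrite ffunE; case: eqP => [kk|_]; last exact: e3.
  by case: (muk u uu); rewrite mu kk.
- move=> u w; rewrite !inE.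
  case: eqP => [->|_] /= uu; case: eqP => [->|_] //= wu k'.
  + by case=> <- /(muk _ wu).
  + by move=> mu [kk]; case: (muk u uu); rewrite mu kk.
  + exact: e4.
- split=> [k'|].
    rewrite ffunE; case: (eqVneq k' k) => [-> _|_].
      by exists v; rewrite ?mem_head ?eqxx.
    case/e5=> u uu mu; exists u; first by rewrite inE uu orbT.
    by case: eqP => // uv; rewrite -uv uu in vus.
  rewrite add1n; apply: leq_trans (_ : #|k |: [set k | c k != None]| <= _).
    apply/subset_leq_card/subsetP => k'; rewrite !inE ffunE.
    by case: (eqVneq k' k).
  by apply: leq_trans (leq_card_setU _ _) _; rewrite cards1 add1n ltnS.
Qed.

End Marks.

Section Preparation.

Variables (T : finType) (r : nat) (O : seq bool -> seq bool).

Notation cellT := (cellT T r).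

Definition auxT : finType := ({set T} + option 'I_r + cellT)%type.

Notation sym := (symbol auxT).
Notation tr := (@tr auxT O).

Definition symB (b : bool) : sym := Some (inl b).
Definition symS (B : {set T}) : sym := Some (inr (inl (inl B))).
Definition symM (m : option 'I_r) : sym := Some (inr (inl (inr m))).
Definition symC (c : cellT) : sym := Some (inr (inr c)).

Definition get_bit (s : sym) : bool := if s is Some (inl b) then b else false.
Definition get_set (s : sym) : {set T} :=
  if s is Some (inr (inl (inl B))) then B else set0.
Definition get_mark (s : sym) : option 'I_r :=
  if s is Some (inr (inl (inr m))) then m else None.
Definition get_cell (s : sym) : cellT :=
  if s is Some (inr (inr c)) then c else [ffun=> None].

Definition read_header : prog auxT :=
  While (fun s => get_bit (s Tin)) (Do (fun s i =>
    match i with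
    | Tin => (s i, MoveR)
    | Trow | Tcol => (symM None, MoveR)
    | _ => (s i, Stay)
    end)).

Definition skip_input : prog auxT :=
  While (fun s => s Tin) (Do (shift MoveR Tin)).

Definition turn_back : prog auxT :=
  Do (fun s i =>
    match i with
    | Tin | Trow | Tcol => (s i, MoveL)
    | Tout => (symB false, Stay)
    | Tcell => (symC [ffun=> None], Stay)
    | Tqry => (s i, Stay)
    end).

Definition read_pin (h : T) : prog auxT :=
  Do (fun s i =>
    match i with
    | Tin => (s i, MoveL)
    | Trow => (symS (if get_bit (s Tin) then h |: get_set (s i)
                     else get_set (s i)), Stay)
    | _ => (s i, Stay)
    end).

Definition set_mark : prog auxT :=
  Do (fun s i =>
    let x := mark_step (get_cell (s Tcell)) (get_set (s Trow)) in
    match i with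
    | Trow | Tcol => (symM x.1, MoveL)
    | Tcell => (symC x.2, Stay)
    | _ => (s i, Stay)
    end).

Definition read_pins : prog auxT :=
  While (fun s => s Trow)
    (Seq (seqs [seq read_pin h | h <- rev (enum T)]) set_mark).

Definition prepare : prog auxT :=
  Seq read_header (Seq skip_input (Seq turn_back (Seq read_pins
    (Seq (Do (shift MoveR Trow)) (Seq (Do (shift MoveR Tcol)) (rewind _ Tin)))))).

Definition mkt (ti tq to tw tl tc : tape auxT) (i : tapename) : tape auxT :=
  match i with
  | Tin => ti | Tqry => tq | Tout => to | Trow => tw | Tcol => tl | Tcell => tc
  end.

Notation B0 := (blank_tape auxT).
Notation bits := (map symB).

Ltac keep_tapes :=
  case=> /=; try first [exact: teq_refl | exact: (@teq_keep _ _ Stay)].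

Lemma tr_read_header n (w : seq bool) :
  tr read_header (n * 2 + 1)
    (mkt ([::], bits (nseq n true ++ false :: w)) B0 B0 B0 B0 B0)
    (mkt (rev (bits (nseq n true)), bits (false :: w)) B0 B0
       (rev (nseq n (symM None)), [::]) (rev (nseq n (symM None)), [::]) B0).
Proof.
pose St (done rest : seq unit) := let k := size done in
  mkt (rev (bits (nseq k true)), bits (nseq (size rest) true ++ false :: w)) B0 B0
    (rev (nseq k (symM None)), [::]) (rev (nseq k (symM None)), [::]) B0.
have := @tr_for _ O _ (fun s => get_bit (s Tin)) _ 1 St (nseq n tt).
rewrite /St /= !size_nseq; apply=> // done [] rest _; split=> //=.
have nr (x : sym) k : rev (nseq k.+1 x) = x :: rev (nseq k x).
  by rewrite -rev_rcons; congr rev; elim: k => //= k ->.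
by apply: tr_do; keep_tapes; rewrite !size_rcons /= ?nr ?map_nseq ?nr; apply: teq_refl.
Qed.

Lemma tr_skip_input (w : seq bool) u to tw tl tc tq :
  tr skip_input (size w * 2 + 1)
    (mkt (rev (bits u), bits w) tq to tw tl tc)
    (mkt (rev (bits (u ++ w)), [::]) tq to tw tl tc).
Proof.
pose St (done rest : seq bool) :=
  mkt (rev (bits (u ++ done)), bits rest) tq to tw tl tc.
have := @tr_for _ O _ (fun s => s Tin) (Do (shift MoveR Tin)) 1 St w.
rewrite /St /= cats0; apply=> // done x rest _; split=> //=.
by apply: tr_do; keep_tapes; rewrite -rcons_cat map_rcons rev_rcons; apply: teq_refl.
Qed.

Definition pin_bits (Bs : seq {set T}) : seq bool :=
  flatten [seq [seq h \in B | h <- enum T] | B : {set T} <- Bs].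

Lemma tr_read_set (u v : seq bool) (B : {set T}) tq to x lw rw tl tc :
  get_set x = set0 ->
  exists2 y, get_set y = B &
  tr (seqs [seq read_pin h | h <- rev (enum T)]) (#|T| * 1 + 1)
    (mkt (at_last (bits (u ++ [seq h \in B | h <- enum T])) (bits v))
       tq to (lw, x :: rw) tl tc)
    (mkt (at_last (bits u) (bits ([seq h \in B | h <- enum T] ++ v)))
       tq to (lw, y :: rw) tl tc).
Proof.
move=> x0.
pose cellsym (done : seq T) : sym :=
  if done is [::] then x else symS [set h in done | h \in B].
have cE done : get_set (cellsym done) = [set h in done | h \in B].
  by case: done => //=; rewrite x0; apply/setP => h; rewrite !inE.
exists (cellsym (rev (enum T))).
  by rewrite cE; apply/setP => h; rewrite !inE mem_rev mem_enum.
pose St (done rest : seq T) :=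
  mkt (at_last (bits (u ++ [seq h \in B | h <- rev rest]))
               (bits ([seq h \in B | h <- rev done] ++ v)))
    tq to (lw, cellsym done :: rw) tl tc.
have := @tr_seqs _ O _ read_pin 1 St (rev (enum T)).
rewrite /St revK size_rev -cardE cats0; apply=> done h rest _.
rewrite rev_cons map_rcons -rcons_cat map_rcons at_last_rcons rev_rcons.
apply: tr_do; keep_tapes; rewrite cE.
have -> : cellsym (rcons done h) = symS [set z in rcons done h | z \in B].
  by case: (done).
suff -> : (if h \in B then h |: [set h in done | h \in B]
           else [set h in done | h \in B]) = [set z in rcons done h | z \in B].
  exact: teq_refl.
apply/setP => z; case: ifPn => hB; rewrite !inE mem_rcons inE;
  by case: eqP => [->|//]; rewrite ?hB ?(negbTE hB) ?andbF.
Qed.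

Lemma pin_bits_rcons Bs B :
  pin_bits (rcons Bs B) = pin_bits Bs ++ [seq h \in B | h <- enum T].
Proof. by rewrite /pin_bits map_rcons flatten_rcons. Qed.

Lemma nseq_rcons (X : Type) k (x : X) : nseq k.+1 x = rcons (nseq k x) x.
Proof. by elim: k => //= k ->. Qed.

Lemma tr_read_pins (base : seq bool) (Bs : seq {set T}) tq to :
  let tw := at_last (nseq (size Bs) (symM None)) [::] in
  let tw' := at_last [::] (map symM (marks r Bs).1) in
  tr read_pins (size Bs * (#|T| + 2).+1 + 1)
    (mkt (at_last (bits (base ++ pin_bits Bs)) [::]) tq to tw tw
       ([::], [:: symC [ffun=> None]]))
    (mkt (at_last (bits base) (bits (pin_bits Bs))) tq to tw' tw'
       ([::], [:: symC (marks r Bs).2])).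
Proof.
pose St (done rest : seq {set T}) :=
  let tw := at_last (nseq (size rest) (symM None)) (map symM (marks r (rev done)).1) in
  mkt (at_last (bits (base ++ pin_bits (rev rest))) (bits (pin_bits (rev done))))
    tq to tw tw ([::], [:: symC (marks r (rev done)).2]).
have := @tr_for _ O _ (fun s => s Trow)
  (Seq (seqs [seq read_pin h | h <- rev (enum T)]) set_mark) (#|T| + 2) St (rev Bs).
rewrite /St revK size_rev cats0; apply=> // done B rest _.
rewrite [size (B :: rest)]/= nseq_rcons at_last_rcons rev_cons rev_rcons; split=> //.
rewrite pin_bits_rcons catA.
have [|y yB s1] := @tr_read_set (base ++ pin_bits (rev rest)) (pin_bits (rev done)) B
  tq to (symM None) (rev (nseq (size rest) (symM None))) (map symM (marks r (rev done)).1)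
  (rev (nseq (size rest) (symM None)), symM None :: map symM (marks r (rev done)).1)
  ([::], [:: symC (marks r (rev done)).2]); first by [].
have -> : #|T| + 2 = #|T| * 1 + 1 + 1 by lia.
apply: tr_seq s1 _; apply: tr_do.
by case; rewrite /= ?yB; first [exact: teq_refl | exact: (@teq_keep _ _ Stay)].
Qed.

Definition ready n w (ms : seq (option 'I_r)) (c : cellT) b :=
  let tw := ([::], map symM ms) in
  mkt ([::], bits (nseq n true ++ w)) B0 ([::], [:: symB b]) tw tw ([::], [:: symC c]).

Lemma tr_prepare (w : seq bool) (Bs : seq {set T}) :
  let n := size Bs in let v := false :: w ++ pin_bits Bs in
  tr prepare (20 * (n * #|T| + n + size w + 1))
    (mkt ([::], bits (nseq n true ++ v)) B0 B0 B0 B0 B0)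
    (ready n v (marks r Bs).1 (marks r Bs).2 false).
Proof.
move=> n v.
have s1 := @tr_read_header n (w ++ pin_bits Bs).
have s2 := @tr_skip_input v (nseq n true) B0
  (rev (nseq n (symM None)), [::]) (rev (nseq n (symM None)), [::]) B0 B0.
pose base := nseq n true ++ false :: w.
pose tw := at_last (nseq n (symM None)) [::].
have tl (s : seq sym) : teq (at_last s [:: None]) (at_last s [::]).
  by split=> // -[|[|[]]].
have s3 : tr turn_back 1
   (mkt (rev (bits (nseq n true ++ v)), [::]) B0 B0
     (rev (nseq n (symM None)), [::]) (rev (nseq n (symM None)), [::]) B0)
   (mkt (at_last (bits (base ++ pin_bits Bs)) [::]) B0 ([::], [:: symB false])
     tw tw ([::], [:: symC [ffun=> None]])).
  apply: tr_do; keep_tapes; rewrite ?/base -?catA; exact: tl.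
have s4 := @tr_read_pins base Bs B0 ([::], [:: symB false]).
pose tw' := at_last [::] (map symM (marks r Bs).1).
pose ti := at_last (bits base) (bits (pin_bits Bs)).
pose tc : tape auxT := ([::], [:: symC (marks r Bs).2]).
pose tw1 : tape auxT := ([::], map symM (marks r Bs).1).
have s5 : tr (Do (shift MoveR Trow)) 1
   (mkt ti B0 ([::], [:: symB false]) tw' tw' tc)
   (mkt ti B0 ([::], [:: symB false]) tw1 tw' tc).
  by apply: tr_do; keep_tapes; apply: teq_blank.
have s6 : tr (Do (shift MoveR Tcol)) 1
   (mkt ti B0 ([::], [:: symB false]) tw1 tw' tc)
   (mkt ti B0 ([::], [:: symB false]) tw1 tw1 tc).
  by apply: tr_do; keep_tapes; apply: teq_blank.
have [b0 [b eb]] : exists b0 b, base = rcons b0 b.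
  by rewrite /base; case/lastP: w {v s1 s2 s3 s4 base ti s5 s6} => [|w x];
    rewrite ?cats1 -?rcons_cons -?rcons_cat; eauto.
have s7 := @tr_rewind _ O Tin (mkt ti B0 ([::], [:: symB false]) tw1 tw1 tc)
  (bits b0) (symB b :: bits (pin_bits Bs)).
have sz : size (pin_bits Bs) = n * #|T|.
  rewrite /pin_bits /n; elim: (Bs) => //= B Bs' IH.
  by rewrite size_cat IH size_map -cardE mulSn.
have szb : size b0 = n + size w.
  by have := congr1 size eb; rewrite size_cat size_nseq size_rcons /=; lia.
apply: tr_weak (tr_seq s1 (tr_seq s2 (tr_seq s3 (tr_seq s4 (tr_seq s5
  (tr_seq s6 (s7 _ _))))))) _ _ _.
- by rewrite all_map; apply/allP.
- by rewrite /= /ti eb map_rcons at_last_rcons.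
- rewrite size_map szb /v /= size_cat sz /n.
  by clear; move: (size Bs) (size w) #|T| => x y z; nia.
- by move=> i; apply: teq_refl.
- case; rewrite /upd /=; try exact: teq_refl.
  by rewrite /v -cat_cons catA -/base eb -!map_cons -map_cat cat_rcons; apply: teq_refl.
Qed.

End Preparation.

Lemma size_flatten_const (X Y : Type) (f : X -> seq Y) k (s : seq X) :
  (forall x, size (f x) = k) -> size (flatten [seq f x | x <- s]) = size s * k.
Proof. by move=> fk; elim: s => //= x s IHs; rewrite size_cat fk IHs mulSn. Qed.

Section Query.

Variables (T : finType) (r : nat) (O : seq bool -> seq bool).

Notation sym := (symbol (auxT T r)).
Notation tr := (@tr (auxT T r) O).
Notation bits := (map (@symB T r)).
Notation prog := (prog (auxT T r)).

Ltac keep_tapes :=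
  case=> /=; try first [exact: teq_refl | exact: (@teq_keep _ _ Stay)].

Definition put (f : (tapename -> sym) -> bool) : prog :=
  Do (fun s i => if i is Tqry then (symB T r (f s), MoveR) else (s i, Stay)).

Definition copy_header : prog :=
  While (fun s => get_bit (s Tin)) (Do (fun s i =>
    match i with
    | Tin => (s i, MoveR)
    | Tqry => (symB T r true, MoveR)
    | _ => (s i, Stay)
    end)).

Definition end_header : prog :=
  Do (fun s i =>
    match i with
    | Tin => (s i, MoveR)
    | Tqry => (symB T r false, MoveR)
    | _ => (s i, Stay)
    end).

Definition copy_row : prog :=
  While (fun s => s Tcol) (Do (fun s i =>
    match i with
    | Tin | Tcol => (s i, MoveR)
    | Tqry => (s Tin, MoveR)
    | _ => (s i, Stay)
    end)).

Definition put_columns (f : option 'I_r -> bool) : prog :=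
  While (fun s => s Tcol) (Do (fun s i =>
    match i with
    | Tcol => (s i, MoveR)
    | Tqry => (symB T r (f (get_mark (s Tcol))), MoveR)
    | _ => (s i, Stay)
    end)).

Definition use_answer (coef : cellT T r -> bool) : prog :=
  Do (fun s i =>
    match i with
    | Tqry => (None, Stay)
    | Tout => (symB T r (get_bit (s i) (+)
                 (coef (get_cell (s Tcell)) && get_bit (s Tqry))), Stay)
    | _ => (s i, Stay)
    end).

Definition written (w : seq bool) : tape (auxT T r) := (rev (bits w), [::]).

Lemma written_rcons w b : written (rcons w b) = (symB T r b :: (written w).1, [::]).
Proof. by rewrite /written map_rcons rev_rcons. Qed.

Lemma tr_puts (X : Type) (f : X -> (tapename -> sym) -> bool) (g : X -> bool)
    xs w ti to tw tl tc :
  (forall x q, f x (fun i => read (mkt ti q to tw tl tc i)) = g x) ->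
  tr (seqs [seq put (f x) | x <- xs]) (size xs * 1 + 1)
    (mkt ti (written w) to tw tl tc)
    (mkt ti (written (w ++ [seq g x | x <- xs])) to tw tl tc).
Proof.
move=> fg.
pose St (d rest : seq X) := mkt ti (written (w ++ [seq g x | x <- d])) to tw tl tc.
have := @tr_seqs _ O _ (fun x => put (f x)) 1 St xs.
rewrite /St cats0; apply=> d x rest _; apply: tr_do; keep_tapes.
by rewrite fg map_rcons -rcons_cat written_rcons; apply: teq_refl.
Qed.

Lemma tr_copy_header n (w : seq bool) to tw tl tc :
  tr copy_header (n * 2 + 1)
    (mkt ([::], bits (nseq n true ++ false :: w)) (blank_tape _) to tw tl tc)
    (mkt (rev (bits (nseq n true)), bits (false :: w)) (written (nseq n true))
       to tw tl tc).
Proof.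
pose St (d rest : seq unit) := let k := size d in
  mkt (rev (bits (nseq k true)), bits (nseq (size rest) true ++ false :: w))
    (written (nseq k true)) to tw tl tc.
have := @tr_for _ O _ (fun s => get_bit (s Tin)) _ 1 St (nseq n tt).
rewrite /St /= !size_nseq; apply=> // d [] rest _; split=> //=.
apply: tr_do; keep_tapes; rewrite size_rcons nseq_rcons ?written_rcons;
  by rewrite ?map_rcons ?rev_rcons; apply: teq_refl.
Qed.

Section Rows.

Variables (V : Type) (mark : V -> option 'I_r).

Let sm (v : V) : sym := symM T (mark v).

Lemma sm_isSome vs : all isSome (map sm vs).
Proof. by elim: vs. Qed.

Lemma tr_copy_row (row : V -> bool) vs u x w to tw tc :
  tr copy_row (size vs * 2 + 1)
    (mkt (rev (bits u), bits ([seq row v | v <- vs] ++ x)) (written w) to tw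
       ([::], map sm vs) tc)
    (mkt (rev (bits (u ++ [seq row v | v <- vs])), bits x)
       (written (w ++ [seq row v | v <- vs])) to tw (rev (map sm vs), [::]) tc).
Proof.
pose St (d rest : seq V) :=
  mkt (rev (bits (u ++ [seq row v | v <- d])), bits ([seq row v | v <- rest] ++ x))
    (written (w ++ [seq row v | v <- d])) to tw (rev (map sm d), map sm rest) tc.
have := @tr_for _ O _ (fun s => s Tcol) _ 1 St vs.
rewrite /St !cats0; apply=> // d v rest _; split=> //=.
apply: tr_do; keep_tapes; rewrite map_rcons -?rcons_cat ?written_rcons;
  by rewrite ?map_rcons ?rev_rcons; apply: teq_refl.
Qed.

Lemma tr_put_columns (f : option 'I_r -> bool) vs w ti to tw tc :
  tr (put_columns f) (size vs * 2 + 1)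
    (mkt ti (written w) to tw ([::], map sm vs) tc)
    (mkt ti (written (w ++ [seq f (mark v) | v <- vs])) to tw
       (rev (map sm vs), [::]) tc).
Proof.
pose St (d rest : seq V) :=
  mkt ti (written (w ++ [seq f (mark v) | v <- d])) to tw
    (rev (map sm d), map sm rest) tc.
have := @tr_for _ O _ (fun s => s Tcol) _ 1 St vs.
rewrite /St !cats0; apply=> // d v rest _; split=> //=.
apply: tr_do; keep_tapes; rewrite map_rcons -?rcons_cat ?written_rcons;
  by rewrite ?map_rcons ?rev_rcons; apply: teq_refl.
Qed.

Lemma tr_rewind_col vs ti tq to tw tc :
  tr (rewind _ Tcol) (2 * size vs + 3)
    (mkt ti tq to tw (rev (map sm vs), [::]) tc)
    (mkt ti tq to tw ([::], map sm vs) tc).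
Proof.
have := @tr_rewind _ O Tcol (mkt ti tq to tw (rev (map sm vs), [::]) tc) (map sm vs) [::].
rewrite size_map cats0 => /(_ (sm_isSome _) erefl) s.
by apply: tr_weak s _ _ _ => //; case.
Qed.

Lemma tr_rewind_row vs ti tq to tl tc :
  tr (rewind _ Trow) (2 * size vs + 3)
    (mkt ti tq to (rev (map sm vs), [::]) tl tc)
    (mkt ti tq to ([::], map sm vs) tl tc).
Proof.
have := @tr_rewind _ O Trow (mkt ti tq to (rev (map sm vs), [::]) tl tc) (map sm vs) [::].
rewrite size_map cats0 => /(_ (sm_isSome _) erefl) s.
by apply: tr_weak s _ _ _ => //; case.
Qed.

Variables (C : Type) (cs : seq C) (att : C -> option 'I_r) (X : C -> C -> bool).

Definition copy_rows : prog :=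
  While (fun s => s Trow)
    (Seq copy_row (Seq (rewind _ Tcol) (Seq
       (seqs [seq put (fun s => meets (att c) (get_mark (s Trow))) | c <- cs])
       (Do (shift MoveR Trow))))).

Definition put_row (c : C) : prog :=
  Seq (put_columns (meets (att c))) (Seq (rewind _ Tcol)
    (seqs [seq put (fun _ => X c c') | c' <- cs])).

Lemma tr_copy_rows (G : V -> V -> bool) vs u x w to tc :
  let old := flatten [seq [seq G v v' | v' <- vs] | v <- vs] in
  let new := flatten [seq [seq G v v' | v' <- vs] ++
                          [seq meets (att c) (mark v) | c <- cs] | v <- vs] in
  tr copy_rows (size vs * (4 * size vs + size cs + 6).+1 + 1)
    (mkt (rev (bits u), bits (old ++ x)) (written w) to
       ([::], map sm vs) ([::], map sm vs) tc)
    (mkt (rev (bits (u ++ old)), bits x) (written (w ++ new)) to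
       (rev (map sm vs), [::]) ([::], map sm vs) tc).
Proof.
pose old d := flatten [seq [seq G v v' | v' <- vs] | v <- d].
pose new d := flatten [seq [seq G v v' | v' <- vs] ++
                           [seq meets (att c) (mark v) | c <- cs] | v <- d].
pose St (d rest : seq V) :=
  mkt (rev (bits (u ++ old d)), bits (old rest ++ x)) (written (w ++ new d)) to
    (rev (map sm d), map sm rest) ([::], map sm vs) tc.
have := @tr_for _ O _ (fun s => s Trow) _ (4 * size vs + size cs + 6) St vs.
rewrite /St !cats0; apply=> // d v rest _; split=> //=.
rewrite [old (v :: rest)]/= -catA.
have s1 := @tr_copy_row (G v) vs (u ++ old d) (old rest ++ x) (w ++ new d) to
  (rev (map sm d), sm v :: map sm rest) tc.
have s2 := @tr_rewind_col vs (rev (bits ((u ++ old d) ++ [seq G v v' | v' <- vs])),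
    bits (old rest ++ x)) (written ((w ++ new d) ++ [seq G v v' | v' <- vs])) to
    (rev (map sm d), sm v :: map sm rest) tc.
have s3 := @tr_puts _ (fun c s => meets (att c) (get_mark (s Trow)))
  (fun c => meets (att c) (mark v)) cs ((w ++ new d) ++ [seq G v v' | v' <- vs])
  (rev (bits ((u ++ old d) ++ [seq G v v' | v' <- vs])), bits (old rest ++ x)) to
  (rev (map sm d), sm v :: map sm rest) ([::], map sm vs) tc (fun _ _ => erefl).
apply: tr_weak (tr_seq s1 (tr_seq s2 (tr_seq s3 (@tr_shift _ _ MoveR Trow _ _ erefl)))) _ _ _.
- by lia.
- by move=> i; apply: teq_refl.
- case; rewrite /upd /=; try exact: teq_refl.
  + by rewrite /old map_rcons flatten_rcons catA; apply: teq_refl.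
  + by rewrite /new map_rcons flatten_rcons !catA; apply: teq_refl.
  + by rewrite map_rcons rev_rcons; apply: teq_refl.
Qed.

Lemma tr_put_rows vs w ti to tw tc :
  let new := flatten [seq [seq meets (att c) (mark v) | v <- vs] ++
                          [seq X c c' | c' <- cs] | c <- cs] in
  tr (seqs [seq put_row c | c <- cs])
    (size cs * (4 * size vs + size cs + 5) + 1)
    (mkt ti (written w) to tw ([::], map sm vs) tc)
    (mkt ti (written (w ++ new)) to tw ([::], map sm vs) tc).
Proof.
pose new d := flatten [seq [seq meets (att c) (mark v) | v <- vs] ++
                           [seq X c c' | c' <- cs] | c <- d].
pose St (d rest : seq C) :=
  mkt ti (written (w ++ new d)) to tw ([::], map sm vs) tc.
have := @tr_seqs _ O _ put_row (4 * size vs + size cs + 5) St cs.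
rewrite /St cats0; apply=> d c rest _.
have s1 := @tr_put_columns (meets (att c)) vs (w ++ new d) ti to tw tc.
have s2 := @tr_rewind_col vs ti
  (written ((w ++ new d) ++ [seq meets (att c) (mark v) | v <- vs])) to tw tc.
have s3 := @tr_puts _ (fun c' _ => X c c') (X c) cs
  ((w ++ new d) ++ [seq meets (att c) (mark v) | v <- vs]) ti to tw
  ([::], map sm vs) tc (fun _ _ => erefl).
apply: tr_weak (tr_seq s1 (tr_seq s2 s3)) _ _ _.
- by lia.
- by move=> i; apply: teq_refl.
- case; rewrite /=; try exact: teq_refl.
  by rewrite /new map_rcons flatten_rcons !catA; apply: teq_refl.
Qed.

Variable coef : cellT T r -> bool.

Definition query : prog :=
  Seq copy_header (Seq (seqs [seq put (fun _ => true) | c <- cs])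
  (Seq end_header (Seq copy_rows (Seq (rewind _ Trow)
  (Seq (seqs [seq put_row c | c <- cs]) (Seq (rewind _ Tqry)
  (Seq (rewind _ Tin) (Seq (Query _) (use_answer coef))))))))).

Lemma tr_query_graph (G : V -> V -> bool) vs x c b ans :
  let n := size vs in
  let old := flatten [seq [seq G v v' | v' <- vs] | v <- vs] in
  let code := nseq (n + size cs) true ++ false ::
    flatten [seq [seq G v v' | v' <- vs] ++
                 [seq meets (att c) (mark v) | c <- cs] | v <- vs] ++
    flatten [seq [seq meets (att c) (mark v) | v <- vs] ++
                 [seq X c c' | c' <- cs] | c <- cs] in
  O code = [:: ans] ->
  tr query (100 * ((n + size cs + 1) * (n + size cs + 1)))
    (ready n (false :: old ++ x) (map mark vs) c b)
    (ready n (false :: old ++ x) (map mark vs) c (b (+) (coef c && ans))).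
Proof.
move=> n old; set new1 := flatten _; set new2 := flatten _ => code Ocode.
pose tm : tape (auxT T r) := ([::], map sm vs).
pose to b : tape (auxT T r) := ([::], [:: symB T r b]).
pose tc : tape (auxT T r) := ([::], [:: symC c]).
have s1 := @tr_copy_header n (old ++ x) (to b) tm tm tc.
have s2 := @tr_puts _ (fun _ _ => true) (fun _ => true) cs (nseq n true)
  (rev (bits (nseq n true)), bits (false :: old ++ x)) (to b) tm tm tc
  (fun _ _ => erefl).
have ecs : [seq true | _ <- cs] = nseq (size cs) true by elim: (cs) => //= ? ? ->.
rewrite ecs -nseqD in s2.
pose w1 := rcons (nseq (n + size cs) true) false.
pose u1 := rcons (nseq n true) false.
have s3 : tr end_header 1
   (mkt (rev (bits (nseq n true)), bits (false :: old ++ x))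
      (written (nseq (n + size cs) true)) (to b) tm tm tc)
   (mkt (rev (bits u1), bits (old ++ x)) (written w1) (to b) tm tm tc).
  apply: tr_do; keep_tapes; rewrite ?written_rcons ?map_rcons ?rev_rcons;
    exact: teq_refl.
have s4 := @tr_copy_rows G vs u1 x w1 (to b) tc.
have s5 := @tr_rewind_row vs (rev (bits (u1 ++ old)), bits x) (written (w1 ++ new1))
  (to b) tm tc.
have s6 := @tr_put_rows vs (w1 ++ new1) (rev (bits (u1 ++ old)), bits x) (to b) tm tc.
have ecode : (w1 ++ new1) ++ new2 = code by rewrite /w1 cat_rcons -catA.
rewrite /= -/new2 ecode in s6.
have bS (w : seq bool) : all isSome (bits w) by elim: w.
have s7 : tr (rewind _ Tqry) (2 * size code + 3)
   (mkt (rev (bits (u1 ++ old)), bits x) (written code) (to b) tm tm tc)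
   (mkt (rev (bits (u1 ++ old)), bits x) ([::], bits code) (to b) tm tm tc).
  have := @tr_rewind _ O Tqry (mkt (rev (bits (u1 ++ old)), bits x) (written code)
    (to b) tm tm tc) (bits code) [::] (bS _) erefl.
  by rewrite size_map cats0 => s; apply: tr_weak s _ _ _ => //; case.
have s8 : tr (rewind _ Tin) (2 * size (u1 ++ old) + 3)
   (mkt (rev (bits (u1 ++ old)), bits x) ([::], bits code) (to b) tm tm tc)
   (mkt ([::], bits (u1 ++ old) ++ bits x) ([::], bits code) (to b) tm tm tc).
  have := @tr_rewind _ O Tin (mkt (rev (bits (u1 ++ old)), bits x)
    ([::], bits code) (to b) tm tm tc) (bits (u1 ++ old)) (bits x) (bS _) erefl.
  by rewrite size_map => s; apply: tr_weak s _ _ _ => //; case.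
have lb w : leading_bits (bits w) = w by elim: w => //= ? ? ->.
have s9 : tr (Query _) 1
   (mkt ([::], bits (u1 ++ old) ++ bits x) ([::], bits code) (to b) tm tm tc)
   (mkt ([::], bits (u1 ++ old) ++ bits x) (tape_of_bits _ [:: ans]) (to b) tm tm tc).
  by apply: tr_query; case=> /=; rewrite /bits_of_tape /= ?lb ?Ocode; apply: teq_refl.
have s10 : tr (use_answer coef) 1
   (mkt ([::], bits (u1 ++ old) ++ bits x) (tape_of_bits _ [:: ans]) (to b) tm tm tc)
   (ready n (false :: old ++ x) (map mark vs) c (b (+) (coef c && ans))).
  apply: tr_do; rewrite /ready; keep_tapes.
  - by rewrite /u1 cat_rcons -map_cat -catA /= map_cat; apply: (@teq_keep _ _ Stay).
  - by split=> // -[|[]].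
  - by rewrite -map_comp; apply: (@teq_keep _ _ Stay).
  - by rewrite -map_comp; apply: (@teq_keep _ _ Stay).
have szo : size old = n * n.
  by rewrite (size_flatten_const (k := n)) // => v; rewrite size_map.
have szu : size (u1 ++ old) = n + 1 + n * n.
  by rewrite size_cat size_rcons size_nseq szo addn1.
have szc : size code = (n + size cs + 1) * (n + size cs) + 1.
  rewrite size_cat size_nseq /= size_cat.
  rewrite (size_flatten_const (k := n + size cs)) => [|v].
    2: by rewrite size_cat !size_map.
  rewrite (size_flatten_const (k := n + size cs)) => [|v].
    2: by rewrite size_cat !size_map.
  by rewrite -/n; lia.
apply: tr_weak (tr_seq s1 (tr_seq s2 (tr_seq s3 (tr_seq s4 (tr_seq s5 (tr_seq s6
  (tr_seq s7 (tr_seq s8 (tr_seq s9 s10))))))))) _ _ _.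
- rewrite szu szc /n; clear; move: (size vs) (size cs) => y z; nia.
- by rewrite /ready -map_comp => i; apply: teq_refl.
- by move=> i; apply: teq_refl.
Qed.

End Rows.

End Query.

Lemma enum_ord_split m n :
  enum 'I_(m + n) = map (lshift n) (enum 'I_m) ++ map (@rshift m n) (enum 'I_n).
Proof.
have valE k : map (@nat_of_ord k) (enum 'I_k) = iota 0 k := val_enum_ord k.
apply: (inj_map (@ord_inj _)); rewrite map_cat valE iotaD add0n.
rewrite -(map_comp (@nat_of_ord _) (lshift n)) -(map_comp _ (@rshift m n)).
congr cat; first by rewrite -valE; apply: eq_map.
by rewrite -[m in iota m]addn0 iotaDl -valE -(map_comp (addn m)); apply: eq_map.
Qed.

Lemma code_attach r n (G : sgraph 'I_n) (mark : 'I_n -> option 'I_r) C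
    (X : sgraph 'I_C) (att : 'I_C -> option 'I_r) :
  code_graph (attach G mark X att) = nseq (n + C) true ++ false ::
    flatten [seq [seq G v v' | v' <- enum 'I_n] ++
                 [seq meets (att c) (mark v) | c <- enum 'I_C] | v <- enum 'I_n] ++
    flatten [seq [seq meets (att c) (mark v) | v <- enum 'I_n] ++
                 [seq X c c' | c' <- enum 'I_C] | c <- enum 'I_C].
Proof.
rewrite /code_graph; congr (_ ++ _ :: _); rewrite !enum_ord_split map_cat flatten_cat.
congr (flatten _ ++ flatten _); rewrite -map_comp; apply: eq_map => i /=;
  rewrite map_cat -!map_comp; congr cat; apply: eq_map => j /=;
  by rewrite /attach_rel ?(unsplitK (inl _)) ?(unsplitK (inr _)).
Qed.

Lemma Orb_Aut (T : finType) (H : sgraph T) (h y : T) s :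
  s \in Aut_graph H -> (s y \in Orb H h) = (y \in Orb H h).
Proof.
move=> sA; apply/imsetP/imsetP => -[a aA e].
  by exists (a * s^-1)%g; rewrite ?groupM ?groupV //= apermE permM -[a h]e permK.
by exists (a * s)%g; rewrite ?groupM // e /= !apermE permM.
Qed.

Section Restrictive.

Variables (T : finType) (H : sgraph T) (r n : nat) (p : 'I_n -> {set T}).
Hypothesis p_restr : restrictive H r p.

Lemma restrictive_invariant v : Aut_invariant H (p v).
Proof.
have [x [xW xT]] := p_restr; move=> s sA y.
have [/existsP[i /eqP->]|/existsPn nv] := boolP [exists i, v == x i].
  have [W ->] := xW i; apply/bigcupP/bigcupP => -[h hW hy]; exists h => //.
    by rewrite -(Orb_Aut h y sA).
  by rewrite Orb_Aut.
by rewrite xT ?inE // => i; apply/eqP.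
Qed.

Lemma restrictive_count : count (fun v => p v != [set: T]) (enum 'I_n) <= r.
Proof.
have [x [xW xT]] := p_restr.
rewrite -size_filter -[r in _ <= r]size_enum_ord -(size_map x).
apply: uniq_leq_size; first by rewrite filter_uniq ?enum_uniq.
move=> v; rewrite mem_filter => /andP[pv _]; apply/mapP.
have [/existsP[i /eqP->]|/existsPn nv] := boolP [exists i, v == x i].
  by exists i; rewrite ?mem_enum.
by rewrite xT ?eqxx // in pv => i; apply/eqP.
Qed.

End Restrictive.

Section Reduction.

Variables (T : finType) (H : sgraph T) (r : nat).

Definition reduction : prog (auxT T r) :=
  Seq (prepare T r)
    (seqs [seq query (enum 'I_(ext_order d)) (@ext_att _ H r d)
             (ext_graph H d) (fun c => ext_coef H c d)
          | d <- enum {ffun 'I_r -> gadget T}]).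

Definition max_ext_order : nat :=
  \max_(d : {ffun 'I_r -> gadget T}) ext_order d.

Lemma tr_reduction O n (G : sgraph 'I_n) (p : 'I_n -> {set T}) :
  solves O (ParityHomsTo H) -> involution_free H -> restrictive H r p ->
  let w := code_graph G ++ code_pinning p in
  exists a, [/\ tr O reduction
      (20 * (n * #|T| + n + n * n + 1) + (#|{: {ffun 'I_r -> gadget T}}| *
         (100 * ((n + max_ext_order + 1) * (n + max_ext_order + 1))) + 1))
      (mkt (tape_of_bits _ w) (blank_tape _) (blank_tape _) (blank_tape _)
         (blank_tape _) (blank_tape _)) a
    & a Tout = ([::], [:: symB T r (odd #|Hom_pinned G H p|)])].
Proof.
move=> OH noinv pr w.
have [mark [e1 e2 e3 e4 [e5 _]]] := marks_spec (enum_uniq 'I_n) (restrictive_count pr).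
pose Bs := [seq p v | v <- enum 'I_n]; set c := (marks r _).2 in e3 e5.
pose mat := flatten [seq [seq G v v' | v' <- enum 'I_n] | v <- enum 'I_n].
pose v := false :: mat ++ pin_bits Bs.
have ew : w = nseq n true ++ v.
  by rewrite /w /code_graph -catA /v /pin_bits -(map_comp _ p).
have szB : size Bs = n by rewrite size_map size_enum_ord.
have s1 := @tr_prepare T r O mat Bs; rewrite /= szB e1 -/c -/v in s1.
pose Q d := attach G mark (ext_graph H d) (@ext_att _ H r d).
pose ans d := odd #|Hom (Q d) H|.
pose St (done rest : seq {ffun 'I_r -> gadget T}) :=
  ready n v (map mark (enum 'I_n)) c
    (\big[addb/false]_(d <- done) (ext_coef H c d && ans d)).
have := @tr_seqs _ O _ (fun d => query (enum 'I_(ext_order d)) (@ext_att _ H r d)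
             (ext_graph H d) (fun c => ext_coef H c d))
   (100 * ((n + max_ext_order + 1) * (n + max_ext_order + 1))) St
   (enum {ffun 'I_r -> gadget T}).
rewrite -cardE /St big_nil => s2.
exists (ready n v (map mark (enum 'I_n)) c (odd #|Hom_pinned G H p|)); split=> //.
rewrite ew; apply: tr_weak (tr_seq s1 (s2 _)) _ _ _.
- move=> d0 d rest _ {s2}.
  have Od : O (code_graph (Q d)) = [:: ans d] := OH (GraphInstance (Q d)).
  rewrite /Q code_attach in Od.
  have := @tr_query_graph T r O _ mark _ (enum 'I_(ext_order d)) (@ext_att _ H r d)
    (ext_graph H d) (fun c => ext_coef H c d) G (enum 'I_n) (pin_bits Bs) c
    (\big[addb/false]_(d <- d0) (ext_coef H c d && ans d)) (ans d).
  rewrite /= !size_enum_ord -big_rcons => /(_ Od) s; apply: tr_weak s _ _ _ => //.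
  rewrite leq_mul2l leq_mul // -!addnA leq_add2l leq_add2r;
    exact: (leq_bigmax_cond (F := @ext_order T r)).
- rewrite (size_flatten_const (k := n)) => [|u]; last by rewrite size_map size_enum_ord.
  by rewrite size_enum_ord.
- by case.
- case; try exact: teq_refl; rewrite big_enum /= (_ : \big[addb/false]_d _ =
    odd #|Hom_pinned G H p|); try exact: teq_refl.
  rewrite (@parity_attach T H r n G mark p c) //.
  + by rewrite odd_sum; apply: eq_bigr => d _; rewrite oddM oddb.
  + exact: restrictive_invariant pr.
  + by move=> u; apply: e2; rewrite mem_enum.
  + by move=> u; apply: e3; rewrite mem_enum.
  + by move=> u u' k; apply: e4; rewrite mem_enum.
  + by move=> k /e5[u _ mu]; exists u.
Qed.

End Reduction.

Theorem theorem3p2 (T : finType) (H : sgraph T) (r : nat)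
    (H_inv_free : involution_free H) (r_pos : 0 < r) :
  poly_time_Turing_reducible (ParityPinnedHomsTo H r) (ParityHomsTo H).
Proof.
pose D := #|{: {ffun 'I_r -> gadget T}}|; pose m := max_ext_order T r.
pose K := 21 + D * (100 * ((m + 1) * (m + 1))).
have qE L : (Poly [:: 0; 0; K]).[L]%R = K * (L * L).
  by rewrite horner_Poly /= GRing.mul0r GRing.add0r !GRing.addr0 mulnA.
exists (machine (reduction H r)), (Poly [:: 0; 0; K])%R => O OH [n G p pr].
rewrite qE /=.
set w := code_graph G ++ code_pinning p.
have [a [s aout]] := tr_reduction G OH H_inv_free pr.
have [i|t [u [let_ ru Ru]]] := s (fun i => if i == Tin then tape_of_bits _ w
  else blank_tape _); first by case: i; apply: teq_refl.
exists (Config (M := machine (reduction H r)) None u); last first.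
  by rewrite /= -(teq_bits (Ru Tout)) aout.
apply: (run_halts ru); apply: leq_trans let_ _.
have szw : size w = n + 1 + n * n + n * #|T|.
  rewrite !size_cat size_nseq /= (size_flatten_const (k := n)).
    2: by move=> v; rewrite size_map size_enum_ord.
  rewrite (size_flatten_const (k := #|T|)).
    2: by move=> v; rewrite size_map -cardE.
  by rewrite size_enum_ord -addn1 (addnC (n * n)) !addnA.
rewrite szw -/D -/m /K; clear; move: #|T| D m => t x y.
set L := n + 1 + n * n + n * t.
have L1 : 20 * (n * t + n + n * n + 1) + 1 <= 21 * (L * L) by rewrite /L; nia.
have L2 : (n + y + 1) * (n + y + 1) <= (y + 1) * (y + 1) * (L * L).
  by rewrite mulnACA leq_mul //; rewrite /L; nia.
have L3 := leq_mul (leqnn x) (leq_mul (leqnn 100) L2).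
rewrite [leqRHS]mulnDl -[x * _ * _]mulnA -[100 * _ * _]mulnA.
by rewrite addnCA addnC leq_add.
Qed.
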